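(* Let $\mathcal V=\nu_1e_1+\nu_2e_2$ be a hyperbolic number with $\mathcal V>_h-1$, i.e. $\nu_1,\nu_2\in\mathbb R$ with $\nu_1,\nu_2>-1$. For $Z=z_1e_1+z_2e_2\in\mathbb{BC}$ let $$|Z\rangle=\frac{1}{\sqrt{\mathscr N_{\mathcal V}(|Z|_h^2)}}\sum_{n=0}^\infty\frac{Z^n}{\sqrt{\rho(n)}}\,|n\rangle,$$ where $$\rho(n)=\sum_{l=1}^2\frac{4^{n_l}\Gamma(n_l+1)\Gamma(\nu_l+n_l+1)}{\Gamma(\nu_l+1)}e_l,\qquad \mathscr N_{\mathcal V}(Y)=\sum_{l=1}^2\sum_{n_l=0}^\infty\frac{\Gamma(\nu_l+1)\,y_l^{n_l}}{4^{n_l}\,n_l!\,\Gamma(\nu_l+n_l+1)}e_l\quad(Y=y_1e_1+y_2e_2).$$ Then these states satisfy: (a) (Normalization) $\langle Z|Z\rangle=1$ for all $Z\in\mathbb{BC}$. (b) (Continuity) $|Z'-Z|_h\to0$ implies $\big\||Z'\rangle-|Z\rangle\big\|\to0$. (c) (Resolution of unity) With the weight function $$\mathcal W(|Z|_h)=\mathscr N_{\mathcal V}(|Z|_h^2)\sum_{l=1}^2W_le_l,\qquad W_l=\frac{1}{4\Gamma(\nu_l+1)}\,G^{\,2,0}_{0,2}\left(\frac{|z_l|^2}{4}\,\middle|\,\begin{matrix}-\\0,\nu_l\end{matrix}\right),$$ one has $\mathcal W(|Z|_h)>_h0$ and $$\int d\mu(Z)\,|Z\rangle\langle Z|=1,\qquad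 d\mu(Z)=\frac{d\psi_Z}{2\pi}\,d(|Z|_h^2)\,\mathcal W(|Z|_h),$$ where $\psi_Z=\theta_1e_1+\theta_2e_2$, $0\le\theta_1,\theta_2<2\pi$, is the hyperbolic angle of $Z$.
   Context: Bicomplex numbers: $\mathbb{BC}=\{\lambda_1+j\lambda_2:\lambda_1,\lambda_2\in\mathbb C(i)\}$ with commuting units $i,j$, $i^2=j^2=-1$, $k=ij$, $k^2=1$; $e_1=\frac{1+k}{2}$, $e_2=\frac{1-k}{2}$, so $e_1+e_2=1$, $e_l^2=e_l$, $e_1e_2=0$, and every $Z$ is uniquely $Z=z_1e_1+z_2e_2$ with $z_l\in\mathbb C(i)$. Hyperbolic numbers are those with $z_1,z_2\in\mathbb R$; $>_h$ is the componentwise order. $|Z|_h=|z_1|e_1+|z_2|e_2$, $|Z|_h^2=|z_1|^2e_1+|z_2|^2e_2$. All functions, square roots and quotients of bicomplex (hyperbolic) quantities are taken componentwise. Fock states: the bicomplex Hilbert space is $\mathcal H=\mathcal H_1e_1+\mathcal H_2e_2$, where each $\mathcal H_l$ is a complex Hilbert space with orthonormal basis $\{|n_l\rangle:n_l=0,1,2,\dots\}$; the inner product is $\langle x|y\rangle=\langle x_1|y_1\rangle e_1+\langle x_2|y_2\rangle e_2$, and $\|\cdot\|$ is the associated (componentwise) norm. One writes $|n\rangle=|n_1\rangle e_1+|n_2\rangle e_2$, with $\langle n|m\rangle=\sum_l\delta_{n_lm_l}e_l$ and $\sum_n|n\rangle\langle n|=1$. Sums over $n$ are understood componentwise, i.e.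 $\sum_n c(n)|n\rangle=\sum_{l=1}^2\Big(\sum_{n_l=0}^\infty c_l(n_l)|n_l\rangle\Big)e_l$ for $c(n)=\sum_lc_l(n_l)e_l$; in particular $Z^n=z_1^{n_1}e_1+z_2^{n_2}e_2$. Integrals are also componentwise: with $z_l=|z_l|e^{i\theta_l}$, $y_l=|z_l|^2$ and $\mathcal W=w_1e_1+w_2e_2$, and $|Z\rangle=|z_1\rangle e_1+|z_2\rangle e_2$, $\int d\mu(Z)|Z\rangle\langle Z|=\sum_{l=1}^2\Big(\int_0^{2\pi}\frac{d\theta_l}{2\pi}\int_0^\infty dy_l\,w_l\,|z_l\rangle\langle z_l|\Big)e_l$ (weak operator sense), and $1$ is the identity of $\mathcal H$. $G^{m,n}_{p,q}$ is the Meijer $G$-function; $G^{2,0}_{0,2}(x\,|\,{-};0,\nu)$ is the function of $x>0$ with Mellin transform $\int_0^\infty x^{s-1}G^{2,0}_{0,2}(x\,|\,{-};0,\nu)\,dx=\Gamma(s)\Gamma(\nu+s)$ for $\Re s>\max(0,-\nu)$. *)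

(* Defs.v *)
From HB Require Import structures.
From mathcomp Require Import all_boot all_order all_algebra.
From mathcomp Require Import all_classical all_reals all_analysis.
From mathcomp Require Import complex ring.

Set Implicit Arguments.
Unset Strict Implicit.
Unset Printing Implicit Defensive.

Import Order.TTheory GRing.Theory Num.Theory.
Import numFieldNormedType.Exports.

Local Open Scope classical_set_scope.
Local Open Scope complex_scope.
Local Open Scope ring_scope.

(* [Bicomplex a b] is a + j b, with a, b in C(i). *)
Record bicomplex (R : realType) := Bicomplex { bcfst : R[i]; bcsnd : R[i] }.

Section BicomplexRing.
Variable R : realType.
Implicit Types X Y Z : bicomplex R.

Definition pair_of_bc Z : R[i] * R[i] := (bcfst Z, bcsnd Z).
Definition bc_of_pair (p : R[i] * R[i]) : bicomplex R := Bicomplex p.1 p.2.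
Lemma pair_of_bcK : cancel pair_of_bc bc_of_pair. Proof. by case. Qed.

HB.instance Definition _ := Choice.copy (bicomplex R) (can_type pair_of_bcK).

Definition bc_add X Y := Bicomplex (bcfst X + bcfst Y) (bcsnd X + bcsnd Y).
Definition bc_opp X := Bicomplex (- bcfst X) (- bcsnd X).
Definition bc_mul X Y :=
  Bicomplex (bcfst X * bcfst Y - bcsnd X * bcsnd Y)
            (bcfst X * bcsnd Y + bcsnd X * bcfst Y).

Fact bc_addA : associative bc_add.
Proof. by move=> [a b] [c d] [e f]; rewrite /bc_add /= !addrA. Qed.
Fact bc_addC : commutative bc_add.
Proof.
by move=> [a b] [c d]; rewrite /bc_add /= [a + c]addrC [b + d]addrC.
Qed.
Fact bc_add0 : left_id (Bicomplex 0 0) bc_add.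
Proof. by move=> [a b]; rewrite /bc_add /= !add0r. Qed.
Fact bc_addN : left_inverse (Bicomplex 0 0) bc_opp bc_add.
Proof. by move=> [a b]; rewrite /bc_add /= !addNr. Qed.

HB.instance Definition _ :=
  GRing.isZmodule.Build (bicomplex R) bc_addA bc_addC bc_add0 bc_addN.

Fact bc_mulA : associative bc_mul.
Proof. by move=> [a b] [c d] [e f]; congr Bicomplex => /=; ring. Qed.
Fact bc_mulC : commutative bc_mul.
Proof. by move=> [a b] [c d]; congr Bicomplex => /=; ring. Qed.
Fact bc_mul1 : left_id (Bicomplex 1 0) bc_mul.
Proof. by move=> [a b]; congr Bicomplex => /=; ring. Qed.
Fact bc_mulD : left_distributive bc_mul bc_add.
Proof. by move=> [a b] [c d] [e f]; congr Bicomplex => /=; ring. Qed.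
Fact bc_oneN0 : Bicomplex 1 0 != 0 :> bicomplex R.
Proof. by apply/eqP => -[] /eqP; rewrite oner_eq0. Qed.

HB.instance Definition _ := GRing.Zmodule_isComNzRing.Build (bicomplex R)
  bc_mulA bc_mulC bc_mul1 bc_mulD bc_oneN0.

Definition bc_complex (z : R[i]) : bicomplex R := Bicomplex z 0.
Definition bc_i : bicomplex R := bc_complex 'i.
Definition bc_j : bicomplex R := Bicomplex 0 1.
Definition bc_k : bicomplex R := bc_i * bc_j.
Definition bc_e1 : bicomplex R := bc_complex 2^-1 * (1 + bc_k).
Definition bc_e2 : bicomplex R := bc_complex 2^-1 * (1 - bc_k).

Definition idem (z1 z2 : R[i]) : bicomplex R :=
  bc_complex z1 * bc_e1 + bc_complex z2 * bc_e2.

(* The coordinates z_1, z_2 of Z = z_1 e_1 + z_2 e_2; see [idemE], [pr1_idem],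
   [pr2_idem]. *)
Definition pr1 Z : R[i] := bcfst Z - 'i * bcsnd Z.
Definition pr2 Z : R[i] := bcfst Z + 'i * bcsnd Z.

Lemma bc_jj : bc_j * bc_j = -1.
Proof. by congr Bicomplex => /=; ring. Qed.

Lemma bc_ii : bc_i * bc_i = -1.
Proof. by congr Bicomplex => /=; rewrite -?expr2 ?sqr_i; ring. Qed.

Lemma idem_mk z1 z2 :
  idem z1 z2 = Bicomplex (2^-1 * (z1 + z2)) ('i * 2^-1 * (z1 - z2)).
Proof. by congr Bicomplex => /=; ring. Qed.

Lemma pr1_idem z1 z2 : pr1 (idem z1 z2) = z1.
Proof.
by rewrite idem_mk /pr1 /= !mulrA -expr2 sqr_i; field.
Qed.

Lemma pr2_idem z1 z2 : pr2 (idem z1 z2) = z2.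
Proof.
by rewrite idem_mk /pr2 /= !mulrA -expr2 sqr_i; field.
Qed.

Lemma idemE Z : Z = idem (pr1 Z) (pr2 Z).
Proof.
case: Z => a b; rewrite idem_mk /pr1 /pr2 /=; congr Bicomplex;
  first by field.
transitivity (- ('i ^+ 2) * b); first by rewrite sqr_i; ring.
by field.
Qed.

Fact pr1_zmod : zmod_morphism pr1.
Proof. by move=> [a b] [c d]; rewrite /pr1 /=; ring. Qed.
Fact pr2_zmod : zmod_morphism pr2.
Proof. by move=> [a b] [c d]; rewrite /pr2 /=; ring. Qed.
Fact pr1_monoid : monoid_morphism pr1.
Proof.
split=> [|[a b] [c d]]; rewrite /pr1 /=; first by ring.
transitivity (a * c + 'i ^+ 2 * (b * d) - 'i * (a * d + b * c)); last by ring.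
by rewrite sqr_i; ring.
Qed.
Fact pr2_monoid : monoid_morphism pr2.
Proof.
split=> [|[a b] [c d]]; rewrite /pr2 /=; first by ring.
transitivity (a * c + 'i ^+ 2 * (b * d) + 'i * (a * d + b * c)); last by ring.
by rewrite sqr_i; ring.
Qed.

HB.instance Definition _ :=
  GRing.isZmodMorphism.Build (bicomplex R) R[i] pr1 pr1_zmod.
HB.instance Definition _ :=
  GRing.isZmodMorphism.Build (bicomplex R) R[i] pr2 pr2_zmod.
HB.instance Definition _ :=
  GRing.isMonoidMorphism.Build (bicomplex R) R[i] pr1 pr1_monoid.
HB.instance Definition _ :=
  GRing.isMonoidMorphism.Build (bicomplex R) R[i] pr2 pr2_monoid.

Definition hyperbolic Z : Prop := pr1 Z \is Num.real /\ pr2 Z \is Num.real.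

Definition hyp (a b : R) : bicomplex R := idem a%:C b%:C.

(* In the order of [R[i]], z < w means that w - z is a positive real. *)
Definition hlt X Y : Prop := pr1 X < pr1 Y /\ pr2 X < pr2 Y.

Definition componentwise (f : R[i] -> R[i]) Z : bicomplex R :=
  idem (f (pr1 Z)) (f (pr2 Z)).

Definition hnorm : bicomplex R -> bicomplex R :=
  componentwise (fun z => `|z|).
Definition bc_sqrt : bicomplex R -> bicomplex R := componentwise sqrtC.
Definition bc_inv : bicomplex R -> bicomplex R := componentwise GRing.inv.

End BicomplexRing.

Arguments idem {R} z1 z2.
Arguments hyp {R} a b.

(* [{dot _ for conjC}] is linear in its first argument. *)
Record hilbert (R : realType) := Hilbert {
  hcarrier :> completeNormedModType R[i];
  hdot : {dot hcarrier for (@Num.conj R[i])};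
  hdot_norm : forall x : hcarrier, `|x| ^+ 2 = hdot x x }.

(* Orthonormality and sum_n |n><n| = 1 (in the strong sense). *)
Definition orthonormal_basis (R : realType) (H : hilbert R) (b : nat -> H) :=
  (forall n m, hdot H (b n) (b m) = (n == m)%:R) /\
  (forall x : H, series (fun n => hdot H x (b n) *: b n) @ \oo --> x).

(* H_1 e_1 + H_2 e_2 *)
Definition bhilbert (R : realType) (H1 H2 : hilbert R) : Type := (H1 * H2)%type.

Section BicomplexHilbert.
Variables (R : realType) (H1 H2 : hilbert R).
Implicit Types x y : bhilbert H1 H2.

HB.instance Definition _ := GRing.Zmodule.copy (bhilbert H1 H2) (H1 * H2)%type.

Definition bh_scale (Z : bicomplex R) x : bhilbert H1 H2 :=
  (pr1 Z *: x.1, pr2 Z *: x.2).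

Fact bh_scaleA (a b : bicomplex R) x :
  bh_scale a (bh_scale b x) = bh_scale (a * b) x.
Proof. by rewrite /bh_scale !rmorphM !scalerA. Qed.
Fact bh_scale1 : left_id 1 bh_scale.
Proof. by move=> [x y]; rewrite /bh_scale !rmorph1 !scale1r. Qed.
Fact bh_scaleDr : right_distributive bh_scale +%R.
Proof. by move=> Z [x y] [x' y']; rewrite /bh_scale /= !scalerDr. Qed.
Fact bh_scaleDl x : {morph bh_scale^~ x : a b / a + b}.
Proof. by move=> a b; rewrite /bh_scale !rmorphD !scalerDl. Qed.

HB.instance Definition _ := GRing.Zmodule_isLmodule.Build
  (bicomplex R) (bhilbert H1 H2) bh_scaleA bh_scale1 bh_scaleDr bh_scaleDl.

(* <x|y>, linear in y *)
Definition braket x y : bicomplex R :=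
  idem (hdot H1 y.1 x.1) (hdot H2 y.2 x.2).

Definition bh_norm x : bicomplex R := idem `|x.1| `|x.2|.

(* sum_n c(n) |n>: with c(n) = c_1(n_1) e_1 + c_2(n_2) e_2, the l-th component
   is the sum of c_l(n_l) |n_l> over n_l.  The summation indices n_1 and n_2 are
   independent of each other, so the two sequences c_1 and c_2 may be packed in
   a single sequence of bicomplex numbers. *)
Definition fock_sum (b1 : nat -> H1) (b2 : nat -> H2) (c : nat -> bicomplex R) :
    bhilbert H1 H2 :=
  (limn (series (fun n => pr1 (c n) *: b1 n)),
   limn (series (fun n => pr2 (c n) *: b2 n))).

End BicomplexHilbert.

Section Integrals.
Variable R : realType.

Definition cintegrable d (T : measurableType d) (mu : {measure set T -> \bar R})
    (D : set T) (f : T -> R[i]) : Prop :=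
  mu.-integrable D (fun x => (complex.Re (f x))%:E) /\
  mu.-integrable D (fun x => (complex.Im (f x))%:E).

Definition cintegral d (T : measurableType d) (mu : {measure set T -> \bar R})
    (D : set T) (f : T -> R[i]) : R[i] :=
  (\int[mu]_(x in D) complex.Re (f x))%R +i*
  (\int[mu]_(x in D) complex.Im (f x))%R.

(* x ^ s = exp (s ln x), for x > 0 *)
Definition cpow (x : R) (s : R[i]) : R[i] :=
  (x `^ complex.Re s)%:C *
  (cos (complex.Im s * ln x) +i* sin (complex.Im s * ln x)).

(* Euler's integrals: meaningful for 0 < x and for 0 < Re s, respectively *)
Definition Gamma (x : R) : R :=
  (\int[lebesgue_measure]_(t in `]0%R, +oo[) (t `^ (x - 1) * expR (- t)))%R.

Definition cGamma (s : R[i]) : R[i] :=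
  cintegral lebesgue_measure `]0%R, +oo[
    (fun t : R => cpow t (s - 1) * (expR (- t))%:C).

Lemma cGamma_real (x : R) : cGamma x%:C = (Gamma x)%:C.
Proof.
rewrite /cGamma /cintegral /Gamma /cpow /=.
have E0 : 0 - 0 = 0 :> R by rewrite subrr.
congr (_ +i* _).
  apply: eq_Rintegral => t _ /=.
  by rewrite E0 mul0r cos0 sin0 !mulr0 !subr0 mulr1.
transitivity (\int[@lebesgue_measure R]_(t in `]0%R, +oo[) (0 : R))%R.
  apply: eq_Rintegral => t _ /=.
  by rewrite E0 mul0r cos0 sin0 !mulr0 !(mul0r, addr0).
by rewrite Rintegral_cst ?mul0r.
Qed.

(* The Mellin transform determines a function only up to a null set: continuity
   singles out the usual representative. *)
Definition is_meijerG2002 (nu : R) (g : R -> R) : Prop :=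
  {in `]0%R, +oo[%classic, continuous g} /\
  forall s : R[i], Num.max 0 (- nu) < complex.Re s ->
    let f (x : R) := cpow x (s - 1) * (g x)%:C in
    cintegrable lebesgue_measure `]0%R, +oo[ f /\
    cintegral lebesgue_measure `]0%R, +oo[ f = cGamma s * cGamma (nu%:C + s).

(* x |-> G^{2,0}_{0,2}(x | -; 0, nu); only the values at x > 0 are specified *)
Definition meijerG2002 (nu : R) : R -> R := get (is_meijerG2002 nu).

End Integrals.

Section States.
Variable R : realType.
Implicit Types (V Y Z : bicomplex R) (nu : R).

Definition nu1 V : R := complex.Re (pr1 V).
Definition nu2 V : R := complex.Re (pr2 V).

Definition rho_component nu (n : nat) : R :=
  4 ^+ n * Gamma (n%:R + 1) * Gamma (nu + n%:R + 1) / Gamma (nu + 1).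

Definition rho V (n : nat) : bicomplex R :=
  hyp (rho_component (nu1 V) n) (rho_component (nu2 V) n).

Definition norm_component nu (y : R) : R :=
  limn (series (fun n =>
    Gamma (nu + 1) * y ^+ n / (4 ^+ n * n`!%:R * Gamma (nu + n%:R + 1)))).

Definition norm_fun V Y : bicomplex R :=
  hyp (norm_component (nu1 V) (complex.Re (pr1 Y)))
      (norm_component (nu2 V) (complex.Re (pr2 Y))).

Definition ket (H1 H2 : hilbert R) (b1 : nat -> H1) (b2 : nat -> H2) V Z :
    bhilbert H1 H2 :=
  bc_inv (bc_sqrt (norm_fun V (hnorm Z ^+ 2))) *:
  fock_sum b1 b2 (fun n => Z ^+ n * bc_inv (bc_sqrt (rho V n))).

(* W_l as a function of r = |z_l| *)
Definition weight_component nu (r : R) : R :=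
  (4 * Gamma (nu + 1))^-1 * meijerG2002 nu (r ^+ 2 / 4).

(* The weight as a function of the hyperbolic number Y = |Z|_h *)
Definition weight V Y : bicomplex R :=
  norm_fun V (Y ^+ 2) *
  hyp (weight_component (nu1 V) (complex.Re (pr1 Y)))
      (weight_component (nu2 V) (complex.Re (pr2 Y))).

(* z = sqrt y * e^(i theta) *)
Definition polar (theta y : R) : R[i] :=
  (Num.sqrt y * cos theta) +i* (Num.sqrt y * sin theta).

Definition polar_integrable (f : R[i] -> R[i]) : Prop :=
  cintegrable ((@lebesgue_measure R) \x (@lebesgue_measure R))%E
    (`[0, 2 * pi[ `*` `]0, +oo[) (fun p : R * R => f (polar p.1 p.2)).

Definition polar_integral (f : R[i] -> R[i]) : R[i] :=
  ((2 * pi)^-1)%:C *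
  cintegral (@lebesgue_measure R) `[0, 2 * pi[ (fun theta : R =>
    cintegral (@lebesgue_measure R) `]0, +oo[ (fun y : R => f (polar theta y))).

(* The integral of F(Z) = f_1(z_1) e_1 + f_2(z_2) e_2 against
   d psi_Z / (2 pi) d(|Z|_h^2) exists and equals I. *)
Definition has_bc_integral (F : bicomplex R -> bicomplex R) (I : bicomplex R) :
    Prop :=
  exists f1 f2 : R[i] -> R[i],
    [/\ forall Z, F Z = idem (f1 (pr1 Z)) (f2 (pr2 Z)),
        polar_integrable f1,
        polar_integrable f2 &
        I = idem (polar_integral f1) (polar_integral f2)].

End States.

(* Main.v *)
(* The weight is made explicit: G(x) = \int_0^oo t^(nu-1) exp(-t - x/t) dt
   (that is 2 x^(nu/2) K_nu(2 sqrt x)) is positive and continuous, and by Fubini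
   and the scaling x = t u its Mellin transform is Gamma(s) Gamma(nu + s).
   A continuous function on ]0, +oo[ is determined by its Mellin transform on one
   vertical line: if x^(s-1) h(x) is orthogonal to all trigonometric polynomials
   in ln x, then it is orthogonal to every indicator of ]b, +oo[, a bounded
   pointwise limit of such polynomials, hence h = 0.  So the Meijer G-function is
   G, which yields positivity of the weight, and its Mellin transform at the
   integers gives \int_0^oo y^n W(sqrt y) dy = rho(n).

   Each component of the unnormalised state is a norm convergent series S(z), with
   |S(z)|^2 = N(|z|^2) >= 1; it is locally Lipschitz in z, and so is S / |S|.

   For the resolution of unity, |<S(z)|u>|^2 is integrated first over the circle
   (Parseval for power series) and then over y = |z|^2 (the moments above), which
   gives 2 pi |u|^2 by monotone convergence; the general matrix element follows by
   polarization. *)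

Require Import Defs.
From HB Require Import structures.
From mathcomp Require Import all_boot all_order all_algebra.
From mathcomp Require Import all_classical all_reals all_analysis.
From mathcomp Require Import measurable_realfun.
From mathcomp Require Import complex ring lra.

Set Implicit Arguments.
Unset Strict Implicit.
Unset Printing Implicit Defensive.
Set SsrOldRewriteGoalsOrder.

Import Order.TTheory GRing.Theory Num.Theory.
Import numFieldNormedType.Exports.

Local Open Scope classical_set_scope.
Local Open Scope ring_scope.

(** * Integration over rectangles and half-lines *)

(** [meijerG2002] is an arbitrary choice among the functions with the prescribed transform, so
    nothing is known of the weight before both existence and uniqueness are proved; positivity at
    every point needs uniqueness pointwise, not almost everywhere. The range -1 < nu allows nu <= 0,
    where t^(nu - 1) exp(-t) is not integrable at 0 by itself: the factor exp(-x/t) saves the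
    integral for x > 0, at the price of bounds that blow up as x tends to 0. Integration is real, so
    x^(s - 1) is carried as a modulus times cos(tau ln x + beta): the phase beta replaces
    multiplication by exp(i beta), and a quarter turn gives the imaginary part. The indicator of a
    half-line is reached in two limits: polynomials in a sine converge to the indicator of the set
    where that sine is positive, and slowing the sine down pushes its other zeros to infinity.
    Matrix elements are reduced to diagonal ones because nonnegative integrands allow Tonelli, and
    the finite value computed that way then gives integrability. *)

Section FubiniIn.
Local Open Scope ereal_scope.
Context d1 d2 (T1 : measurableType d1) (T2 : measurableType d2) (R : realType).
Variables (m1 : {sigma_finite_measure set T1 -> \bar R}).
Variables (m2 : {sigma_finite_measure set T2 -> \bar R}).
Variables (D1 : set T1) (D2 : set T2).
Hypotheses (mD1 : measurable D1) (mD2 : measurable D2).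
Let T : measurableType _ := (T1 * T2)%type.
Implicit Types f : T -> \bar R.

(** Extension by zero off the rectangle: this identity and the next carry Fubini and Tonelli on the
    whole product over to a rectangle. *)
Let patch12 f x : \int[m2]_y (f \_ (D1 `*` D2)) (x, y) =
  ((fun x => \int[m2]_(y in D2) f (x, y)) \_ D1) x.
Proof.
rewrite [RHS]patchE; case: ifPn => xD1.
  rewrite [RHS]integral_mkcond; apply: eq_integral => y _.
  by rewrite !patchE in_setX /= xD1.
by rewrite integral0_eq// => y _; rewrite patchE in_setX /= (negbTE xD1).
Qed.

Let patch21 f y : \int[m1]_x (f \_ (D1 `*` D2)) (x, y) =
  ((fun y => \int[m1]_(x in D1) f (x, y)) \_ D2) y.
Proof.
rewrite [RHS]patchE; case: ifPn => yD2.
  rewrite [RHS]integral_mkcond; apply: eq_integral => x _.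
  by rewrite !patchE in_setX /= yD2 andbT.
by rewrite integral0_eq// => x _; rewrite patchE in_setX /= (negbTE yD2) andbF.
Qed.

Let mD12 : measurable (D1 `*` D2). Proof. exact: measurableX. Qed.

Section Tonelli.
Variable f : T -> \bar R.
Hypotheses (mf : measurable_fun (D1 `*` D2) f).
Hypotheses (f0 : forall p, (D1 `*` D2) p -> 0 <= f p).

Let mf' : measurable_fun setT (f \_ (D1 `*` D2)).
Proof. by apply/(measurable_restrictT _ _).1. Qed.

Let f0' p : 0 <= (f \_ (D1 `*` D2)) p.
Proof. by rewrite patchE; case: ifPn => // /set_mem; exact: f0. Qed.

Lemma tonelli21_in : \int[m1 \x m2]_(p in D1 `*` D2) f p =
  \int[m2]_(y in D2) \int[m1]_(x in D1) f (x, y).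
Proof.
rewrite [LHS]integral_mkcond (fubini_tonelli2 _ mf' f0') [RHS]integral_mkcond.
by apply: eq_integral => x _; rewrite -patch21.
Qed.

End Tonelli.

Section Fubini.
Variable f : T -> \bar R.
Hypothesis fi : (m1 \x m2).-integrable (D1 `*` D2) f.

Let fi' : (m1 \x m2).-integrable setT (f \_ (D1 `*` D2)).
Proof. exact/(integrable_mkcond _ _).1. Qed.

Lemma fubini12_in : \int[m1 \x m2]_(p in D1 `*` D2) f p =
  \int[m1]_(x in D1) \int[m2]_(y in D2) f (x, y).
Proof.
rewrite [LHS]integral_mkcond -(integral12_prod_meas1 fi') [RHS]integral_mkcond.
by apply: eq_integral => x _; rewrite -patch12.
Qed.

Lemma fubini21_in : \int[m1 \x m2]_(p in D1 `*` D2) f p =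
  \int[m2]_(y in D2) \int[m1]_(x in D1) f (x, y).
Proof.
rewrite [LHS]integral_mkcond -(integral21_prod_meas1 fi') [RHS]integral_mkcond.
by apply: eq_integral => x _; rewrite -patch21.
Qed.

Lemma integrable_fubini12_in :
  m1.-integrable D1 (fun x => \int[m2]_(y in D2) f (x, y)).
Proof.
apply/(integrable_mkcond _ mD1).2.
have := @integrable_fubini_F _ _ _ _ _ m1 m2 _ fi'.
by congr (integrable _ _ _); apply/funext => x; rewrite -patch12.
Qed.

End Fubini.
End FubiniIn.

Section Scaling.
Variables (R : realType) (c : R).
Local Notation mu := (@lebesgue_measure R).
Local Notation pos := (`]0%R, +oo[%classic : set R).
Implicit Types f : R -> \bar R.

Let scale : measurableTypeR R -> measurableTypeR R := *%R c.
Let mscale_fun : measurable_fun setT scale.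
Proof. exact: mulrl_measurable. Qed.
(** Kept transparent, so that [mscale k pmu] unfolds to c times the pushforward. *)
Let pmu : {measure set (measurableTypeR R) -> \bar R}.
Proof.
by unshelve refine (pushforward mu scale : measure _ _); exact: mscale_fun.
Defined.

(** By uniqueness of Lebesgue measure it is enough to compare both sides on half-open intervals. *)
Lemma lebesgue_measure_scale (A : set R) : 0 < c -> measurable A ->
  (c%:E * pushforward mu scale A)%E = mu A.
Proof.
move=> c0 mA.
pose k := NngNum (ltW c0).
have -> : (c%:E * pushforward mu scale A)%E =
  mscale k pmu A by [].
apply/esym/lebesgue_measure_unique => //= _ [[a b]] _ <-.
have E : scale @^-1` `]a, b] = `](c^-1 * a), (c^-1 * b)]%classic.
  apply/seteqP; split => t /=; rewrite !in_itv/=;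
  by rewrite ltr_pdivrMl// ler_pdivlMl.
rewrite [RHS](_ : _ = (c%:E * mu `](c^-1 * a)%R, (c^-1 * b)%R])%E); last first.
  by rewrite -E.
rewrite !lebesgue_measure_itv/= !lte_fin ltr_pM2l ?invr_gt0//.
case: ifPn => _; last by rewrite mule0.
by rewrite -!EFinB -EFinM -mulrBr mulrA divff ?mul1r ?gt_eqF.
Qed.

Lemma ge0_integral_scale f : 0 < c -> measurable_fun pos f ->
  (forall x, pos x -> (0 <= f x)%E) ->
  (\int[mu]_(x in pos) f x = c%:E * \int[mu]_(x in pos) f (c * x)%R)%E.
Proof.
move=> c0 mf f0.
pose k := NngNum (ltW c0).
transitivity (\int[mscale k pmu]_(x in pos) f x)%E.
  apply: eq_measure_integral => A mA _.
  by rewrite -[LHS]lebesgue_measure_scale.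
rewrite ge0_integral_mscale//.
rewrite /pmu/= (ge0_integral_pushforward mscale_fun)//; last first.
  by move=> x /set_mem; exact: f0.
congr (_ * _)%E; rewrite (_ : _ @^-1` _ = pos)//.
by apply/seteqP; split => x /=; rewrite !in_itv/= !andbT pmulr_rgt0.
Qed.

Let scale_pos : 0 < c -> {homo *%R c : x / pos x}.
Proof. by move=> c0 x /=; rewrite !in_itv/= !andbT pmulr_rgt0. Qed.

Lemma measurable_scale f : 0 < c -> measurable_fun pos f ->
  measurable_fun pos (fun x => f (c * x)).
Proof.
move=> c0 mf; apply: (measurable_comp (F := pos)) => //.
  by move=> _ [x px <-]; exact: scale_pos.
Qed.

Lemma integrable_scale f : 0 < c -> mu.-integrable pos f ->
  mu.-integrable pos (fun x => f (c * x)).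
Proof.
move=> c0 /integrableP[mf foo]; apply/integrableP; split.
  exact: measurable_scale.
move: foo; rewrite ge0_integral_scale//; last exact: measurableT_comp.
rewrite !ltey; apply: contra => /eqP ->.
by rewrite gt0_muley// lte_fin.
Qed.

Lemma integral_scale f : 0 < c -> mu.-integrable pos f ->
  (\int[mu]_(x in pos) f x = c%:E * \int[mu]_(x in pos) f (c * x)%R)%E.
Proof.
move=> c0 fi; have mf := measurable_int mu fi.
rewrite integralE [in RHS]integralE.
rewrite (@ge0_integral_scale (f^\+)%E)//; last exact: measurable_funepos.
rewrite (@ge0_integral_scale (f^\-)%E)//; last exact: measurable_funeneg.
rewrite -muleBr//.
  by congr (_ * (_ - _))%E; apply: eq_integral => x _; rewrite ?(funeposE,funenegE).
(* Distributing c over the difference of the two parts requires one of them to be finite;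
   integrability provides it. *)
apply: fin_num_adde_defl; rewrite fin_numN.
have /(integrable_neg_fin_num _) := integrable_scale c0 fi => /(_ (measurable_itv _)).
rewrite [X in X \is a _ -> _](_ : _ = \int[mu]_(x in pos) (f^\- (c * x)%R))%E//.
by apply: eq_integral => x _; rewrite !funenegE.
Qed.

End Scaling.

(** * The Gamma integral *)

Section GammaIntegral.
Variable R : realType.
Local Notation mu := (@lebesgue_measure R).
Local Notation pos := (`]0%R, +oo[%classic : set R).

Definition gamma_kernel (s t : R) : R := t `^ (s - 1) * expR (- t).

Lemma measurable_gamma_kernel (s : R) D : measurable_fun D (gamma_kernel s).
Proof.
apply: measurable_funTS; apply: measurable_funM; first exact: measurable_powR.
by apply: measurableT_comp; [exact: measurable_expR|exact: measurable_funN].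
Qed.

Lemma gamma_kernel_ge0 s t : 0 <= gamma_kernel s t.
Proof. by rewrite mulr_ge0 ?powR_ge0 ?expR_ge0. Qed.

(** A zero integral would make [f] vanish almost everywhere on [D], and since [f] is positive there,
    [D] would be null. *)
Lemma integral_gt0 d (T : measurableType d) (m : {measure set T -> \bar R})
    (D : set T) (f : T -> \bar R) : measurable D -> measurable_fun D f ->
  (forall x, D x -> (0 < f x)%E) -> m D != 0%E -> (0 < \int[m]_(x in D) f x)%E.
Proof.
move=> mD mf f0; apply: contra_neqT; rewrite -leNgt => i0.
have i_eq : (\int[m]_(x in D) `|f x| = 0)%E.
  rewrite (eq_integral f); last by move=> x /set_mem /f0 /ltW /gee0_abs.
  by apply/eqP; rewrite eq_le i0 integral_ge0// => x /f0 /ltW.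
have [N [mN N0 DN]] := (ae_eq_integral_abs m mD mf).1 i_eq.
apply/eqP; rewrite eq_le measure_ge0 andbT -N0 le_measure ?inE//.
by move=> x Dx; apply: DN => /= /(_ Dx) fx; move: (f0 _ Dx); rewrite fx ltxx.
Qed.

(** Exhaust the interval by compact pieces away from 0; on each of them the primitive t^(a+1) /
    (a+1) bounds the integral by 1 / (a+1). *)
Lemma integral_powR_itv01 (a : R) : -1 < a ->
  (\int[mu]_(t in `]0%R, 1%R]) (t `^ a)%:E < +oo)%E.
Proof.
move=> a1; have a0 : 0 < a + 1 by lra.
(* The shift by 2 keeps the left end strictly below 1 already for n = 0, as the fundamental theorem
   of calculus requires. *)
pose F n := `[n.+2%:R^-1 : R, 1]%classic.
have n0 n : 0 < n.+2%:R^-1 :> R by rewrite invr_gt0 ltr0n.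
have UF : `]0%R, 1%R]%classic = \bigcup_n F n.
  apply/seteqP; split => x /=.
    rewrite in_itv/= => /andP[x0 x1].
    exists (Num.truncn x^-1) => //; rewrite /F /= in_itv/= x1 andbT.
    rewrite invf_ple ?posrE ?ltr0n//.
    by rewrite ltW// (lt_le_trans (truncnS_gt _))// ler_nat.
  by move=> [n _]; rewrite /F /= !in_itv/= => /andP[/(lt_le_trans (n0 n))-> ->].
have cvgF : (\int[mu]_(t in F n) (t `^ a)%:E @[n --> \oo] -->
    \int[mu]_(t in `]0%R, 1%R]) (t `^ a)%:E)%E.
  rewrite UF; apply: ge0_nondecreasing_set_cvg_integral => //.
  - move=> n m nm; apply/subsetPset => x; rewrite /F /= !in_itv/= => /andP[nx ->].
    by rewrite (le_trans _ nx)// lef_pV2 ?posrE ?ltr0n// ler_nat.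
  - by move=> i; exact: measurable_itv.
  - by move=> i; apply/measurable_EFinP; apply: measurable_funTS; exact: measurable_powR.
  - by move=> i x _; rewrite lee_fin powR_ge0.
rewrite -(cvg_lim _ cvgF)//.
apply: (@le_lt_trans _ _ ((a + 1)^-1)%:E); last exact: ltry.
apply: lime_le; first by apply/cvg_ex; eexists; exact: cvgF.
apply: nearW => n.
pose G t := (a + 1)^-1 * t `^ (a + 1).
have dG (x : R) : 0 < x -> is_derive x 1 G (x `^ a).
  move=> x0.
  have := is_deriveZ (a + 1)^-1 (is_derive1_powR (a + 1) x0).
  by rewrite -[in X in is_derive _ _ _ X]addrA subrr addr0 scalerA mulVf ?scale1r ?gt_eqF.
have cG (x : R) : 0 < x -> {for x, continuous G}.
  move=> /dG h; apply: differentiable_continuous; apply/derivable1_diffP.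
  exact: ex_derive.
rewrite (@continuous_FTC2 _ _ G).
- rewrite -EFinD lee_fin /G powR1 mulr1 lerBlDr lerDl.
  by rewrite mulr_ge0 ?powR_ge0// invr_ge0 ltW.
- by rewrite invf_lt1 ?ltr0n// ltr1n.
- apply: continuous_in_subspaceT => x /set_mem /=; rewrite in_itv/= => /andP[nx _].
  have /is_derive1_powR - /(_ a) h : 0 < x by exact: lt_le_trans nx.
  apply: differentiable_continuous; apply/derivable1_diffP.
  exact: ex_derive.
- split.
  + move=> x; rewrite in_itv/= => /andP[nx _].
    by have h := dG x (lt_trans (n0 n) nx); exact: ex_derive.
  + by apply: cvg_at_right_filter; exact: cG.
  + by apply: cvg_at_left_filter; exact: cG.
- move=> x; rewrite in_itv/= => /andP[nx _].
  by have h := dG x (lt_trans (n0 n) nx); rewrite derive1E; apply: derive_val.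
Qed.

Lemma integral_expRN : (\int[mu]_(t in pos) (expR (- t))%:E = 1)%E.
Proof.
have c : continuous (fun t : R => expR (- t)).
  by move=> x; apply: continuous_comp; [exact: opp_continuous|exact: continuous_expR].
rewrite integral_itv_obnd_cbnd; last first.
  by apply/measurable_EFinP/measurable_funTS; exact: continuous_measurable_fun.
have dE (x : R) : is_derive x 1 (fun t => - expR (- t)) (expR (- x)).
  rewrite (_ : (fun _ => _) = - (expR \o -%R))//.
  apply: is_derive_eq; rewrite -[RHS]opprK; congr (- _).
  by rewrite mulrN1.
rewrite (@ge0_continuous_FTC2y _ _ (fun t => - expR (- t)) 0 0).
- by rewrite oppr0 expR0 -EFinD opprK add0r.
- by move=> x _; exact: expR_ge0.
- exact: continuous_subspaceT.
- by rewrite -[X in _ --> X]oppr0; apply: cvgN; exact: cvgr_expR.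
- by move=> x _; apply: ex_derive.
- by apply: cvg_at_right_filter; apply: cvgN; exact: c.
- by move=> x _; rewrite derive1E; apply: derive_val.
Qed.

Lemma integrable_expRN (c : R) : 0 < c ->
  mu.-integrable pos (fun t => (expR (- (c * t)))%:E).
Proof.
move=> c0; apply: (@integrable_scale _ c (fun t => (expR (- t))%:E)) => //.
apply/integrableP; split.
  apply/measurable_EFinP/measurable_funTS.
  by apply: measurableT_comp; [exact: measurable_expR|exact: measurable_funN].
under eq_integral do rewrite gee0_abs ?lee_fin ?expR_ge0//.
by rewrite integral_expRN ltry.
Qed.

(** This is u <= exp(u) for u = t / (2p), raised to the power p. *)
Lemma powR_le_expR (p t : R) : 0 < p -> 0 <= t ->
  t `^ p <= (2 * p) `^ p * expR (t / 2).
Proof.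
move=> p0 t0.
have -> : t / 2 = t / (2 * p) * p by field; rewrite gt_eqF.
rewrite expRM -powRM ?expR_ge0 ?mulr_ge0 ?(ltW p0)//.
apply: (ge0_ler_powR (ltW p0)); rewrite ?nnegrE ?mulr_ge0 ?expR_ge0 ?(ltW p0)//.
rewrite -ler_pdivrMl ?mulr_gt0// mulrC.
by apply: le_trans (expR_ge1Dx _); rewrite lerDr.
Qed.

(** Split at 1: before it the exponential is at most 1, after it half of the exponential absorbs the
    power. *)
Lemma integrable_gamma_kernel (s : R) : 0 < s ->
  mu.-integrable pos (EFin \o gamma_kernel s).
Proof.
move=> s0; apply/integrableP; split.
  apply/measurable_EFinP; exact: measurable_gamma_kernel.
under eq_integral do rewrite gee0_abs ?lee_fin ?gamma_kernel_ge0//.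
have -> : pos = (`]0, 1] `|` `]1, +oo[).
  by rewrite -itv_bndbnd_setU ?bnd_simp.
rewrite ge0_integral_setU//=; first last.
- apply/disj_setPRL => x /=; rewrite !in_itv/= andbT => x1.
  by move=> /andP[_ /le_lt_trans/(_ x1)]; rewrite ltxx.
- by move=> x _; rewrite lee_fin gamma_kernel_ge0.
- apply/measurable_EFinP; exact: measurable_gamma_kernel.
apply: lte_add_pinfty.
  have /integral_powR_itv01 : -1 < s - 1 by lra.
  apply: le_lt_trans; apply: ge0_le_integral => //.
  - by move=> x _; rewrite lee_fin gamma_kernel_ge0.
  - apply/measurable_EFinP; exact: measurable_gamma_kernel.
  - by apply/measurable_EFinP; apply: measurable_funTS; exact: measurable_powR.
  move=> x /=; rewrite in_itv/= => /andP[x0 _].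
  by rewrite lee_fin ler_piMr ?powR_ge0// -expR0 ler_expR lerNl oppr0 ltW.
(* [powR_le_expR] wants a positive exponent, which s - 1 need not be; for t > 1, replacing s - 1 by
   the larger p only increases the power. *)
pose p := `|s - 1| + 1.
have p0 : 0 < p by rewrite ltr_wpDl.
have h0 : 0 < (2^-1 : R) by rewrite invr_gt0.
have : mu.-integrable pos (fun t => ((2 * p) `^ p)%:E * (expR (- (2^-1 * t)))%:E)%E.
  by apply: integrableZl => //; exact: integrable_expRN.
move=> /integrableP[mg]; apply: le_lt_trans.
under [leRHS]eq_integral do rewrite gee0_abs ?mule_ge0 ?lee_fin ?powR_ge0 ?expR_ge0//.
apply: (@le_trans _ _ (\int[mu]_(x in `]1%R, +oo[) ((2 * p) `^ p * expR (- (2^-1 * x)))%:E)%E).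
  apply: ge0_le_integral => //.
  - by move=> x _; rewrite lee_fin gamma_kernel_ge0.
  - apply/measurable_EFinP; exact: measurable_gamma_kernel.
  - have : measurable_fun pos (fun x : R => ((2 * p) `^ p * expR (- (2^-1 * x)))%:E) by [].
    apply: measurable_funS => //.
    by move=> x /=; rewrite !in_itv/= !andbT; apply: lt_trans.
  move=> x /=; rewrite in_itv/= andbT => x1; rewrite lee_fin.
  have -> : - (2^-1 * x) = x / 2 - x by field.
  rewrite expRD mulrA ler_pM2r ?expR_gt0//.
  apply: le_trans (powR_le_expR p0 _); last by rewrite ltW// (lt_trans _ x1).
  apply: ler_powR; first exact: ltW.
  by rewrite /p (le_trans (ler_norm _))// lerDl.
apply: ge0_subset_integral => //.
- by move=> x _; rewrite lee_fin mulr_ge0 ?powR_ge0 ?expR_ge0.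
- by move=> x /=; rewrite !in_itv/= !andbT; apply: lt_trans.
Qed.

Lemma EFin_Gamma (s : R) : 0 < s ->
  (\int[mu]_(t in pos) (gamma_kernel s t)%:E = (Gamma s)%:E)%E.
Proof.
by move=> s0; rewrite /Gamma /Rintegral fineK//; apply: integrable_fin_num => //;
  exact: integrable_gamma_kernel.
Qed.

Lemma lebesgue_measure_pos : mu pos != 0%E.
Proof. by rewrite lebesgue_measure_itv/= ltry. Qed.

Lemma Gamma_gt0 (s : R) : 0 < s -> 0 < Gamma s.
Proof.
move=> s0; rewrite -lte_fin -EFin_Gamma// integral_gt0//.
- apply/measurable_EFinP; exact: measurable_gamma_kernel.
- move=> x /=; rewrite in_itv/= andbT => x0.
  by rewrite lte_fin mulr_gt0 ?powR_gt0 ?expR_gt0.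
- exact: lebesgue_measure_pos.
Qed.

(** The part of the integral over the unit interval [[M, M + 1]] already suffices. As [M] is free,
    Gamma outgrows every geometric sequence, which yields convergence of the states for all z. *)
Lemma Gamma_ge_powR (s M : R) : 1 <= s -> 0 < M ->
  M `^ (s - 1) * expR (- (M + 1)) <= Gamma s.
Proof.
move=> s1 M0; have s0 : 0 < s by rewrite (lt_le_trans _ s1).
rewrite -lee_fin -EFin_Gamma//.
apply: (@le_trans _ _ (\int[mu]_(t in `[M, (M + 1)%R]) (gamma_kernel s t)%:E)%E).
  apply: (@le_trans _ _ (\int[mu]_(t in `[M, (M + 1)%R]) (M `^ (s - 1) * expR (- (M + 1)))%:E)%E).
    rewrite integral_cst//= lebesgue_measure_itv/= lte_fin ltrDl ltr01 -EFinB.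
    by rewrite addrAC subrr add0r mule1.
  apply: ge0_le_integral => //.
  - by move=> x _; rewrite lee_fin mulr_ge0 ?powR_ge0 ?expR_ge0.
  - apply/measurable_EFinP; exact: measurable_gamma_kernel.
  - move=> x /=; rewrite in_itv/= => /andP[Mx xM]; rewrite lee_fin ler_pM ?powR_ge0 ?expR_ge0//.
      by apply: ge0_ler_powR; rewrite ?nnegrE ?subr_ge0 ?(le_trans (ltW M0))// ltW.
    by rewrite ler_expR lerN2.
apply: ge0_subset_integral => //.
- apply/measurable_EFinP; exact: measurable_gamma_kernel.
- by move=> x _; rewrite lee_fin gamma_kernel_ge0.
- by move=> x /=; rewrite !in_itv/= andbT => /andP[Mx _]; exact: lt_le_trans Mx.
Qed.

End GammaIntegral.

Section GammaNat.
Variable R : realType.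
Local Notation mu := (@lebesgue_measure R).
Local Notation pos := (`]0%R, +oo[%classic : set R).

(* [- fact_poly n t * expR (- t)] is a primitive of [t ^+ n * expR (- t)]. *)
Fixpoint fact_poly (n : nat) (t : R) : R :=
  if n is n'.+1 then t ^+ n + n%:R * fact_poly n' t else 1.

Lemma is_derive_fact_poly n (t : R) :
  is_derive t 1 (fact_poly n) (fact_poly n t - t ^+ n).
Proof.
elim: n => [|n IH] /=.
  by rewrite expr0 subrr; exact: is_derive_cst.

rewrite (_ : (fun _ => _) = id ^+ n.+1 + n.+1%:R \*: fact_poly n)//; last first.
  by apply/funext => x; rewrite fctE.
apply: is_derive_eq; rewrite /GRing.scale/=.
ring.
Qed.

(** Used for the limit of the primitive at infinity: after multiplication by exp(-t), a factor
    exp(-t/2) remains. *)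
Lemma fact_poly_le n : exists C : R, forall t, 0 <= t ->
  0 <= fact_poly n t <= C * expR (t / 2).
Proof.
elim: n => [|n [C IH]] /=.
  by exists 1 => t t0; rewrite ler01 mul1r -expR0 ler_expR divr_ge0.
(* The first summand comes from a single Taylor term, (t/2)^(n+1) / (n+1)! <= exp(t/2), the second
   from the recursion. *)
exists (2 ^+ n.+1 * n.+1`!%:R + n.+1%:R * C) => t t0.
have /andP[P0 PC] := IH _ t0.
rewrite addr_ge0 ?exprn_ge0 ?mulr_ge0//= mulrDl lerD//; last first.
  by rewrite -mulrA ler_wpM2l.
have t20 : 0 <= t / 2 by rewrite divr_ge0.
have h : (t / 2) ^+ n.+1 / n.+1`!%:R <= expR (t / 2).
  by apply: le_trans (expR_ge1Dxn n t20); rewrite lerDr.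
rewrite -[leLHS](_ : 2 ^+ n.+1 * n.+1`!%:R * ((t / 2) ^+ n.+1 / n.+1`!%:R) = _).
  by rewrite ler_wpM2l// mulr_ge0// exprn_ge0.
rewrite expr_div_n; field.
by rewrite expf_neq0//= pnatr_eq0 -lt0n fact_gt0.
Qed.

(** Reconciles the Gamma(n + 1) of [rho_component] with the n! of [norm_component]. *)
Lemma Gamma_nat n : Gamma (n%:R + 1 : R) = n`!%:R.
Proof.
apply: EFin_inj; rewrite -EFin_Gamma; last by rewrite ltr_wpDl.
transitivity (\int[mu]_(t in pos) (t ^+ n * expR (- t))%:E)%E.
  apply: eq_integral => t /set_mem /=; rewrite in_itv/= andbT => t0.
  by rewrite /gamma_kernel addrK powR_mulrn// ltW.
have c : continuous (fun t : R => t ^+ n * expR (- t)).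
  move=> x; apply: (@continuousM _ R^o (fun t => t ^+ n) (fun t => expR (- t))).
    exact: exprn_continuous.
  by apply: continuous_comp; [exact: opp_continuous|exact: continuous_expR].
rewrite integral_itv_obnd_cbnd; last first.
  by apply/measurable_EFinP; apply: measurable_funTS; exact: continuous_measurable_fun.
pose F := fun t : R => - (fact_poly n t * expR (- t)).
have dF (x : R) : is_derive x 1 F (x ^+ n * expR (- x)).
  rewrite (_ : F = - (fact_poly n * (expR \o -%R)))//.
  have := is_derive_fact_poly n x => ?.
  apply: is_derive_eq; rewrite /GRing.scale/=; ring.
have cF : continuous F.
  by move=> x; apply: differentiable_continuous; apply/derivable1_diffP; apply: ex_derive.
rewrite (@ge0_continuous_FTC2y _ _ F 0 0).
- rewrite /F oppr0 expR0 mulr1 -EFinD opprK add0r; congr EFin.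
  elim: n {c F dF cF} => [|n IH] //=.
  by rewrite IH expr0n add0r factS natrM.
- by move=> x x0; rewrite mulr_ge0 ?exprn_ge0 ?expR_ge0.
- exact: continuous_subspaceT.
- rewrite -[X in _ --> X]oppr0; apply: cvgN.
  have [C hC] := fact_poly_le n.
  apply: (@squeeze_cvgr _ _ _ _ (cst 0) (fun t => C * expR (- (2^-1 * t)))).
  + near=> t; have t0 : 0 <= t by near: t; exact: nbhs_pinfty_ge.
    have /andP[P0 PC] := hC _ t0; rewrite mulr_ge0 ?expR_ge0//=.
    rewrite (_ : - (2^-1 * t) = t / 2 - t); last by field.
    by rewrite expRD mulrA ler_pM2r ?expR_gt0.
  + exact: cvg_cst.
  + rewrite -[X in _ --> X](mulr0 C); apply: cvgMr.
    apply: (@cvg_comp _ _ _ _ (fun z => expR (- z)) _ (pinfty_nbhs R)); last exact: cvgr_expR.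
    exact: gt0_cvgMry.
- by move=> x _; apply: ex_derive.
- by apply: cvg_at_right_filter; exact: cF.
- by move=> x _; rewrite derive1E; apply: derive_val.
Unshelve. all: by end_near. Qed.

End GammaNat.

(** * The Mellin transform of the Meijer integral *)

Lemma integrableZl_EFin d (T : measurableType d) (R : realType)
    (m : {measure set T -> \bar R}) (D : set T) (k : R) (f : T -> R) :
  measurable D -> m.-integrable D (fun x => (f x)%:E) ->
  m.-integrable D (fun x => (k * f x)%:E).
Proof.
by move=> mD fi; apply: eq_integrable (integrableZl mD k fi) => //.
Qed.

Section MellinMeijer.
Variable R : realType.
Local Notation mu := (@lebesgue_measure R).
Local Notation pos := (`]0%R, +oo[%classic : set R).
Implicit Types s tau beta nu x t : R.

(* beta = 0 and beta = - pi / 2 give the real and imaginary parts of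
   x ^ (s + i tau - 1). *)
Definition cospow s tau beta x : R := x `^ (s - 1) * cos (tau * ln x + beta).

Lemma measurable_cospow s tau beta D : measurable_fun D (cospow s tau beta).
Proof.
apply: measurable_funTS; apply: measurable_funM; first exact: measurable_powR.
apply: measurableT_comp; first by apply: continuous_measurable_fun; exact: continuous_cos.
apply: measurable_funD => //.
by apply: measurable_funM => //; exact: measurable_ln.
Qed.

Lemma cospow_le s tau beta x : `|cospow s tau beta x| <= x `^ (s - 1).
Proof.
rewrite normrM ger0_norm ?powR_ge0// ler_piMr ?powR_ge0//.
by rewrite ler_norml cos_geN1 cos_le1.
Qed.

Lemma cospow00 s x : cospow s 0 0 x = x `^ (s - 1).
Proof. by rewrite /cospow mul0r addr0 cos0 mulr1. Qed.

Lemma cospowM s tau beta t x : 0 < t -> 0 < x ->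
  cospow s tau beta (t * x) = t `^ (s - 1) * cospow s tau (tau * ln t + beta) x.
Proof.
move=> t0 x0; rewrite /cospow powRM ?ltW// lnM ?posrE// -mulrA; congr (_ * (_ * cos _)).
by ring.
Qed.

Lemma cospowD s tau beta gamma x : cospow s tau (beta + gamma) x =
  cos gamma * cospow s tau beta x - sin gamma * cospow s tau (beta - pi / 2) x.
Proof.
rewrite /cospow !addrA cosD cosBpihalf; ring.
Qed.

(** The real part of exp(i beta) Gamma(s + i tau). *)
Definition mellin_expR s tau beta : R :=
  (\int[mu]_(x in pos) (cospow s tau beta x * expR (- x)))%R.

Lemma measurable_mellin_expR s tau beta D :
  measurable_fun D (fun x => cospow s tau beta x * expR (- x)).
Proof.
apply: measurable_funM; first exact: measurable_cospow.
apply: measurable_funTS; apply: measurableT_comp; first exact: measurable_expR.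
exact: measurable_funN.
Qed.

Lemma integrable_mellin_expR s tau beta : 0 < s ->
  mu.-integrable pos (fun x => (cospow s tau beta x * expR (- x))%:E).
Proof.
move=> s0; apply: le_integrable (integrable_gamma_kernel s0) => //.
  by apply/measurable_EFinP; exact: measurable_mellin_expR.
move=> x _; rewrite lee_fin [leRHS]ger0_norm ?gamma_kernel_ge0//.
by rewrite normrM (ger0_norm (expR_ge0 _)) ler_wpM2r ?expR_ge0 ?cospow_le.
Qed.

Lemma EFin_mellin_expR s tau beta : 0 < s ->
  (\int[mu]_(x in pos) (cospow s tau beta x * expR (- x))%:E =
  (mellin_expR s tau beta)%:E)%E.
Proof.
by move=> s0; rewrite /mellin_expR /Rintegral fineK//; apply: integrable_fin_num => //;
  exact: integrable_mellin_expR.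
Qed.

Lemma mellin_expRD s tau beta gamma : 0 < s ->
  mellin_expR s tau (beta + gamma) =
  cos gamma * mellin_expR s tau beta -
  sin gamma * mellin_expR s tau (beta - pi / 2).
Proof.
move=> s0; have i b := integrable_mellin_expR tau b s0.
rewrite /mellin_expR -(RintegralZl _ _ (i beta))// -(RintegralZl _ _ (i (beta - pi / 2)))//.
rewrite -RintegralB//; [|exact: integrableZl_EFin..].
by apply: eq_Rintegral => x _; rewrite cospowD; ring.
Qed.

Lemma mellin_expR00 s : mellin_expR s 0 0 = Gamma s.
Proof. by rewrite /mellin_expR /Gamma; apply: eq_Rintegral => x _; rewrite cospow00. Qed.

(** The substitution x = t u pulls out t^(s + i tau): its modulus is the factor in front, its
    argument the shift of the phase. *)
Lemma mellin_expR_scale s tau beta t : 0 < s -> 0 < t ->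
  (\int[mu]_(x in pos) (cospow s tau beta x * expR (- (x / t)))%:E =
  (t `^ s * mellin_expR s tau (tau * ln t + beta))%:E)%E.
Proof.
move=> s0 t0; have ti0 : 0 < t^-1 by rewrite invr_gt0.
pose g x := ((cospow s tau (tau * ln t + beta) x * expR (- x))%:E).
have gi : mu.-integrable pos g by exact: integrable_mellin_expR.
transitivity (\int[mu]_(x in pos) ((t `^ (s - 1))%:E * g (t^-1 * x)%R))%E.
  apply: eq_integral => x /set_mem /=; rewrite in_itv/= andbT => x0.
  rewrite /g -EFinM; congr EFin; rewrite mulrA -cospowM//; last by rewrite mulr_gt0.
  by rewrite mulrA divff ?mul1r ?gt_eqF// [t^-1 * x]mulrC.
rewrite integralZl//; last exact: integrable_scale.
have := integral_scale ti0 gi; rewrite [LHS]EFin_mellin_expR// => h.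
have {h} h : (t%:E * (mellin_expR s tau (tau * ln t + beta))%:E =
   \int[mu]_(x in pos) g (t^-1 * x)%R)%E.
  by rewrite h muleA -EFinM divff ?mul1e ?gt_eqF.
rewrite -h -!EFinM; congr EFin; rewrite mulrA; congr (_ * _).
by rewrite mulrC mulr_powRB1// ltW.
Qed.

Definition meijer_kernel nu x t : R := gamma_kernel nu t * expR (- (x / t)).

Definition meijer_integral nu x : R :=
  (\int[mu]_(t in pos) meijer_kernel nu x t)%R.

Lemma meijer_kernel_ge0 nu x t : 0 <= meijer_kernel nu x t.
Proof. by rewrite mulr_ge0 ?gamma_kernel_ge0 ?expR_ge0. Qed.

(* The factor 1 / x pays for one power of t, so that nu > -1 is enough. *)
Lemma meijer_kernel_le nu x t : 0 < x -> 0 < t ->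
  meijer_kernel nu x t <= x^-1 * gamma_kernel (nu + 1) t.
Proof.
move=> x0 t0.
have u0 : 0 < x / t by rewrite divr_gt0.
have h : expR (- (x / t)) <= x^-1 * t.
  rewrite expRN -[x^-1 * t]invrK lef_pV2 ?posrE ?expR_gt0//.
    rewrite invfM invrK; apply: le_trans (expR_ge1Dx _); by rewrite lerDr.
  by rewrite invr_gt0 mulr_gt0 ?invr_gt0.
apply: (le_trans (ler_wpM2l (gamma_kernel_ge0 _ _) h)).
rewrite /gamma_kernel addrK.
have -> : t `^ nu = t `^ (nu - 1) * t.
  by rewrite -[X in _ = _ * X]powRr1 ?ltW// -powRD ?subrK// (gt_eqF t0) implybT.
by rewrite le_eqVlt; apply/orP; left; apply/eqP; ring.
Qed.

Lemma measurable_meijer_kernel nu x D :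
  measurable D -> D `<=` pos -> measurable_fun D (meijer_kernel nu x).
Proof.
move=> mD Dp; apply: measurable_funM; first exact: measurable_gamma_kernel.
(* On the half-line, 1/t agrees with the real power of exponent -1, which is measurable
   everywhere. *)
apply: (eq_measurable_fun (fun t => expR (- (x * t `^ (-1))))).
  move=> t /set_mem /Dp /=; rewrite in_itv/= andbT => t0.
  by rewrite powR_inv1// ltW.
apply: measurable_funTS; apply: measurableT_comp; first exact: measurable_expR.
apply: measurable_funN; apply: measurable_funM => //.
Qed.

Lemma integrable_meijer_kernel nu x : -1 < nu -> 0 < x ->
  mu.-integrable pos (fun t => (meijer_kernel nu x t)%:E).
Proof.
move=> nu1 x0; have nu0 : 0 < nu + 1 by lra.
have : mu.-integrable pos (fun t => (x^-1 * gamma_kernel (nu + 1) t)%:E).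
  by apply: integrableZl_EFin => //; exact: integrable_gamma_kernel.
apply: le_integrable => //.
  by apply/measurable_EFinP; exact: measurable_meijer_kernel.
move=> t /=; rewrite in_itv/= andbT => t0.
rewrite lee_fin ger0_norm ?meijer_kernel_ge0//.
by apply: le_trans (ler_norm _); exact: meijer_kernel_le.
Qed.

Lemma EFin_meijer_integral nu x : -1 < nu -> 0 < x ->
  (\int[mu]_(t in pos) (meijer_kernel nu x t)%:E = (meijer_integral nu x)%:E)%E.
Proof.
by move=> nu1 x0; rewrite /meijer_integral /Rintegral fineK//;
  apply: integrable_fin_num => //; exact: integrable_meijer_kernel.
Qed.

Lemma meijer_integral_gt0 nu x : -1 < nu -> 0 < x -> 0 < meijer_integral nu x.
Proof.
move=> nu1 x0; rewrite -lte_fin -EFin_meijer_integral// integral_gt0//.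
- by apply/measurable_EFinP; exact: measurable_meijer_kernel.
- move=> t /=; rewrite in_itv/= andbT => t0.
  by rewrite lte_fin !mulr_gt0 ?powR_gt0 ?expR_gt0.
- exact: lebesgue_measure_pos.
Qed.

(** The bound of [meijer_kernel_le] degrades near x = 0, so the argument is local: on the window []x
    / 2, x + 1[] the kernel is dominated by 2/x times [gamma_kernel (nu + 1)]. *)
Lemma continuous_meijer_integral nu : -1 < nu ->
  {in pos, continuous (meijer_integral nu)}.
Proof.
move=> nu1 x /set_mem /=; rewrite in_itv/= andbT => x0.
have nu0 : 0 < nu + 1 by lra.
have x20 : 0 < x / 2 by rewrite divr_gt0.
apply: (@continuity_under_integral _ _ _ mu (meijer_kernel nu) pos _ (x / 2) (x + 1)
  _ _ (fun t => (x / 2)^-1 * gamma_kernel (nu + 1) t)).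
- exact: measurable_itv.
- move=> y /=; rewrite in_itv/= => /andP[xy _].
  by apply: integrable_meijer_kernel => //; exact: lt_trans xy.
- apply: aeW => t _ y _.
  apply: (@continuousM _ R^o (cst (gamma_kernel nu t)) (fun y => expR (- (y / t)))).
    exact: cvg_cst.
  apply: continuous_comp; last exact: continuous_expR.
  by apply: cvgN; apply: cvgM; [exact: cvg_id|exact: cvg_cst].
- by apply: integrableZl_EFin => //; exact: integrable_gamma_kernel.
- move=> y /=; rewrite in_itv/= => /andP[xy _]; apply: aeW => t /=.
  rewrite in_itv/= andbT => t0; rewrite ger0_norm ?meijer_kernel_ge0//.
  apply: le_trans (meijer_kernel_le _ _ t0) _; first exact: lt_trans xy.
  by rewrite ler_wpM2r ?gamma_kernel_ge0// lef_pV2 ?posrE ?ltW// (lt_trans _ xy).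
- by rewrite inE/= in_itv/= ltr_pdivrMr// ltr_pMr// ltr1n ltrDl ltr01.
Qed.

Section MellinTransform.
Variables s nu : R.
Hypotheses (s0 : 0 < s) (snu0 : 0 < nu + s) (nu1 : -1 < nu).

Let F tau beta (p : R * R) := (cospow s tau beta p.1 * meijer_kernel nu p.1 p.2)%:E.

Let measurableF tau beta : measurable_fun (pos `*` pos) (F tau beta).
Proof.
apply/measurable_EFinP; apply: measurable_funM.
  apply: measurable_funTS; apply: measurableT_comp; first exact: measurable_cospow.
  exact: measurable_fst.
apply: measurable_funM.
  apply: measurable_funTS; apply: measurableT_comp; first exact: measurable_gamma_kernel.
  exact: measurable_snd.
apply: (eq_measurable_fun (fun p : R * R => expR (- (p.1 * p.2 `^ (-1))))).
  move=> [x t] /set_mem [_ /=]; rewrite in_itv/= andbT => t0.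
  by rewrite powR_inv1// ltW.
apply: measurable_funTS; apply: measurableT_comp; first exact: measurable_expR.
apply: measurable_funN; apply: measurable_funM; first exact: measurable_fst.
apply: (measurableT_comp (f := fun t : R => t `^ (-1))); last exact: measurable_snd.
exact: measurable_powR.
Qed.

Let F21 tau beta t : 0 < t ->
  (\int[mu]_(x in pos) F tau beta (x, t) =
  (gamma_kernel (nu + s) t * mellin_expR s tau (tau * ln t + beta))%:E)%E.
Proof.
move=> t0.
transitivity (\int[mu]_(x in pos) ((gamma_kernel nu t)%:E *
    (cospow s tau beta x * expR (- (x / t)))%:E))%E.
  apply: eq_integral => x _; rewrite -EFinM; congr EFin.
  by rewrite /meijer_kernel/=; ring.
have := mellin_expR_scale tau beta s0 t0.
set I := integral _ _ _ => IE.
rewrite integralZl//; last first.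
  apply/integrableP; split.
    apply/measurable_EFinP; apply: measurable_funM; first exact: measurable_cospow.
    apply: measurable_funTS; apply: measurableT_comp; first exact: measurable_expR.
    by apply: measurable_funN; apply: measurable_funM.
  (* The case without oscillation dominates, and [mellin_expR_scale] evaluates it to a finite
     number. *)
  have h : (\int[mu]_(x in pos) (x `^ (s - 1) * expR (- (x / t)))%:E =
      (t `^ s * mellin_expR s 0 (0 * ln t + 0))%:E)%E.
    by rewrite -mellin_expR_scale//; apply: eq_integral => x _; rewrite cospow00.
  apply: (@le_lt_trans _ _ (t `^ s * mellin_expR s 0 (0 * ln t + 0))%:E); last exact: ltry.
  rewrite -h.
  apply: ge0_le_integral => //.
  - apply: measurableT_comp => //; apply/measurable_EFinP.
    apply: measurable_funM; first exact: measurable_cospow.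
    apply: measurable_funTS; apply: measurableT_comp; first exact: measurable_expR.
    by apply: measurable_funN; apply: measurable_funM.
  - apply/measurable_EFinP; apply: measurable_funTS.
    apply: measurable_funM; first exact: measurable_powR.
    apply: measurableT_comp; first exact: measurable_expR.
    by apply: measurable_funN; apply: measurable_funM.
  - move=> x _; rewrite lee_fin normrM (ger0_norm (expR_ge0 _)).
    by rewrite ler_wpM2r ?expR_ge0 ?cospow_le.
rewrite -/I IE -EFinM; congr EFin; rewrite mulrA; congr (_ * _).
rewrite /gamma_kernel mulrAC -powRD ?(gt_eqF t0) ?implybT//.
by congr (_ `^ _ * _); ring.
Qed.

Let F00_ge0 p : (0 <= F 0 0 p)%E.
Proof. by rewrite lee_fin mulr_ge0 ?meijer_kernel_ge0// cospow00 powR_ge0. Qed.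

(** Without oscillation the integrand is nonnegative, so Tonelli applies and gives Gamma(s) Gamma(nu
    + s). Since it dominates every [F tau beta], Fubini becomes available for all of them. *)
Let F00_lty : (\int[mu \x mu]_(p in pos `*` pos) F 0 0 p < +oo)%E.
Proof.
rewrite tonelli21_in//; last exact: measurableF.
have -> : (\int[mu]_(t in pos) \int[mu]_(x in pos) F 0 0 (x, t) =
    \int[mu]_(t in pos) ((Gamma s)%:E * (gamma_kernel (nu + s) t)%:E))%E.
  apply: eq_integral => t /set_mem /=; rewrite in_itv/= andbT => t0.
  by rewrite F21// mul0r addr0 mellin_expR00 mulrC EFinM.
rewrite integralZl//; last exact: integrable_gamma_kernel.
by rewrite EFin_Gamma// -EFinM ltry.
Qed.

Let integrableF tau beta : (mu \x mu)%E.-integrable (pos `*` pos) (F tau beta).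
Proof.
apply/integrableP; split; first exact: measurableF.
apply: le_lt_trans F00_lty.
apply: ge0_le_integral => //; first exact: measurableX.
  by apply: measurableT_comp => //; exact: measurableF.
  exact: measurableF.
move=> p _; rewrite lee_fin normrM (ger0_norm (meijer_kernel_ge0 _ _ _)).
by rewrite ler_wpM2r ?meijer_kernel_ge0// cospow00 cospow_le.
Qed.

Let F12 tau beta x : 0 < x ->
  (\int[mu]_(t in pos) F tau beta (x, t) =
  (cospow s tau beta x * meijer_integral nu x)%:E)%E.
Proof.
move=> x0; rewrite EFinM -EFin_meijer_integral// -integralZl//.
exact: integrable_meijer_kernel.
Qed.

Lemma integrable_mellin_meijer tau beta :
  mu.-integrable pos (fun x => (cospow s tau beta x * meijer_integral nu x)%:E).
Proof.
have : mu.-integrable pos (fun x => \int[mu]_(t in pos) F tau beta (x, t))%E.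
  by apply: integrable_fubini12_in => //; exact: integrableF.
apply: eq_integrable => // x /set_mem /=; rewrite in_itv/= andbT => x0.
exact: F12.
Qed.

(** This is Re(z w) = Re z Re w - Im z Im w for z = Gamma(s + i tau) and w = exp(i beta) Gamma(nu +
    s + i tau), since lowering the phase by a quarter turn exchanges the real part for the imaginary
    part. *)
Lemma mellin_meijer tau beta :
  (\int[mu]_(x in pos) (cospow s tau beta x * meijer_integral nu x))%R =
  mellin_expR s tau 0 * mellin_expR (nu + s) tau beta -
  mellin_expR s tau (- (pi / 2)) * mellin_expR (nu + s) tau (beta - pi / 2).
Proof.
apply: EFin_inj.
rewrite [LHS]fineK; last first.
  by apply: integrable_fin_num => //; exact: integrable_mellin_meijer.
transitivity (\int[mu]_(x in pos) \int[mu]_(t in pos) F tau beta (x, t))%E.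
  by apply: eq_integral => x /set_mem /=; rewrite in_itv/= andbT => x0; rewrite F12.
rewrite -fubini12_in// fubini21_in//.
have i b := integrable_mellin_expR tau b snu0.
rewrite EFinB !EFinM -(EFin_mellin_expR tau beta snu0).
rewrite -(EFin_mellin_expR tau (beta - pi / 2) snu0).
rewrite -!integralZl// -integralB//; [|by apply: integrableZl => //; exact: i..].
apply: eq_integral => t /set_mem /=; rewrite in_itv/= andbT => t0.
rewrite F21//= -!EFinM -EFinB; congr EFin.
rewrite -[X in mellin_expR s tau X]add0r mellin_expRD// sub0r.
rewrite /gamma_kernel /cospow addrA cosBpihalf; ring.
Qed.

End MellinTransform.

End MellinMeijer.

(** * Uniqueness of the Mellin transform *)

Section PolynomialStep.
Variable R : realType.
Implicit Types t q x : R.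

Lemma bernoulli_sub x m : 0 <= x <= 1 -> 1 - m%:R * x <= (1 - x) ^+ m.
Proof.
move=> /andP[x0 x1]; elim: m => [|m IH]; first by rewrite mul0r subr0 expr0.
rewrite exprS; apply: le_trans (ler_wpM2l _ IH); last by rewrite subr_ge0.
have h : 0 <= m%:R * x ^+ 2 by rewrite mulr_ge0 // sqr_ge0.
rewrite -subr_ge0; apply: le_trans h _; rewrite -natr1 expr2 le_eqVlt; apply/orP; left.
by apply/eqP; ring.
Qed.

(** With q = r^2, one factor r^n bounds n r^n by 1 / (1 - r), and the other one tends to 0. *)
Lemma cvg_natM_geometric q : 0 <= q < 1 -> (n%:R * q ^+ n @[n --> \oo] --> 0).
Proof.
move=> /andP[q0 q1]; pose r := Num.sqrt q.
have r0 : 0 <= r by exact: sqrtr_ge0.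
have r1 : r < 1 by rewrite -[X in _ < X]sqrtr1 ltr_sqrt.
have rq n : q ^+ n = r ^+ n * r ^+ n by rewrite -exprMn -expr2 sqr_sqrtr.
have h n : n%:R * r ^+ n * (1 - r) <= 1.
  (* The extra summand r^n strengthens the claim so that the induction closes. *)
  suff : n%:R * r ^+ n * (1 - r) + r ^+ n <= 1.
    by apply: le_trans; rewrite lerDl exprn_ge0.
  elim: n => [|n IH]; first by rewrite !mul0r add0r expr0.
  have rn : r ^+ n.+1 <= 1 by rewrite exprn_ile1// ltW.
  have h1 := ler_wpM2l r0 IH.
  have h2 : r ^+ n.+1 * (1 - r) <= 1 - r by rewrite ler_piMl// subr_ge0 ltW.
  have := lerD h1 h2; rewrite mulr1 subrKC; apply: le_trans.
  by rewrite le_eqVlt; apply/orP; left; apply/eqP; rewrite -natr1 exprS; ring.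
apply: (@squeeze_cvgr _ _ _ _ (cst 0) (fun n => (1 - r)^-1 * r ^+ n)).
- apply: nearW => n; rewrite mulr_ge0 ?exprn_ge0//= rq mulrA ler_wpM2r ?exprn_ge0//.
  by rewrite -[leRHS]mul1r ler_pdivlMr ?subr_gt0.
- exact: cvg_cst.
- rewrite -[X in _ --> X](mulr0 (1 - r)^-1); apply: cvgMr.
  by apply: cvg_expr; rewrite ger0_norm.
Qed.

(* With the exponent 2 ^ n the limit at t = 1/2 would be exp(-1); the additional
   factor n makes it 0 there and leaves the limits elsewhere unchanged. *)
Definition step_poly n t := (1 - t ^+ n) ^+ (n * 2 ^ n).

Lemma step_poly_itv n t : 0 <= t <= 1 -> 0 <= step_poly n t <= 1.
Proof.
move=> /andP[t0 t1]; have h : 0 <= 1 - t ^+ n <= 1.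
  by rewrite subr_ge0 exprn_ile1// gerBl exprn_ge0.
by rewrite exprn_ge0 ?exprn_ile1 ?(andP h).1 ?(andP h).2.
Qed.

(** Below 1/2, Bernoulli's inequality bounds the defect by n (2t)^n. From 1/2 on, 1 - t^n <=
    exp(-2^(-n)), which the exponent n 2^n turns into exp(-n). *)
Lemma cvg_step_poly t : 0 <= t <= 1 ->
  step_poly n t @[n --> \oo] --> (if t < 1 / 2 then 1 else 0 : R).
Proof.
move=> t01; have /andP[t0 t1] := t01; case: ltP => t2.
  apply: (@squeeze_cvgr _ _ _ _ (fun n => 1 - n%:R * (2 * t) ^+ n) (cst 1)).
  - apply: nearW => n; rewrite (andP (step_poly_itv n t01)).2 andbT.
    apply: le_trans (bernoulli_sub (n * 2 ^ n) _).
      by rewrite natrM natrX exprMn mulrA.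
    by rewrite exprn_ge0// exprn_ile1.
  - rewrite -[X in _ --> X]subr0; apply: cvgB; first exact: cvg_cst.
    apply: cvg_natM_geometric; apply/andP; split; lra.
  - exact: cvg_cst.
apply: (@squeeze_cvgr _ _ _ _ (cst 0) (fun n => expR (1 *- n))).
- apply: nearW => n; rewrite (andP (step_poly_itv n t01)).1/=.
  have h : 1 - t ^+ n <= expR (- (2^-1) ^+ n).
    apply: le_trans (expR_ge1Dx _); rewrite lerD2l lerN2.
    by rewrite lerXn2r ?nnegrE//; lra.
  apply: (@le_trans _ _ (expR (- (2^-1) ^+ n) ^+ (n * 2 ^ n))).
    by rewrite lerXn2r ?nnegrE ?expR_ge0// subr_ge0 exprn_ile1.
  by rewrite -expRM_natl ler_expR natrM natrX mulrN -mulrA -exprMn divff// expr1n mulr1.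
- exact: cvg_cst.
- exact: cvgn_expR.
Qed.

End PolynomialStep.

Section MellinUniqueness.
Variable R : realType.
Local Notation mu := (@lebesgue_measure R).
Local Notation pos := (`]0%R, +oo[%classic : set R).

Inductive trig_poly : (R -> R) -> Prop :=
| trig_cos a b : trig_poly (fun v => cos (a * v + b))
| trig_add p q : trig_poly p -> trig_poly q -> trig_poly (fun v => p v + q v)
| trig_scale k p : trig_poly p -> trig_poly (fun v => k * p v).

Lemma trig_ext p q : p =1 q -> trig_poly p -> trig_poly q.
Proof. by move=> /funext ->. Qed.

Lemma trig_cst k : trig_poly (fun=> k).
Proof.
apply: trig_ext (trig_scale k (trig_cos 0 0)) => v /=.
by rewrite mul0r addr0 cos0 mulr1.
Qed.

(** The product-to-sum formula for cosines is the base case; with this closure, polynomials in a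
    sine stay in the class. *)
Lemma trig_mul p q : trig_poly p -> trig_poly q -> trig_poly (fun v => p v * q v).
Proof.
move=> tp tq; elim: tp => {p} [a b|p p' _ IH _ IH'|k p _ IH].
- elim: tq => {q} [c d|q q' _ IH _ IH'|k q _ IH].
  + apply: trig_ext (trig_add (trig_scale (1 / 2) (trig_cos (a + c) (b + d)))
      (trig_scale (1 / 2) (trig_cos (a - c) (b - d)))) => v /=.
    have -> : (a + c) * v + (b + d) = (a * v + b) + (c * v + d) by ring.
    have -> : (a - c) * v + (b - d) = (a * v + b) - (c * v + d) by ring.
    by rewrite cosD cosB; field.
  + by apply: trig_ext (trig_add IH IH') => v; rewrite mulrDr.
  + by apply: trig_ext (trig_scale k IH) => v; rewrite mulrCA.
- by apply: trig_ext (trig_add IH IH') => v; rewrite mulrDl.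
- by apply: trig_ext (trig_scale k IH) => v; rewrite mulrA.
Qed.

Lemma trig_exp p n : trig_poly p -> trig_poly (fun v => p v ^+ n).
Proof.
move=> tp; elim: n => [|n IH]; first exact: trig_ext (trig_cst 1).
by apply: trig_ext (trig_mul tp IH) => v; rewrite exprS.
Qed.

(** Moves the sine into [0, 1], where [step_poly] lives, so that a positive sine corresponds to a
    value below the threshold 1/2. *)
Definition sin_half (eta b v : R) := (1 - sin (eta * (v - b))) / 2.

Lemma sin_half_itv eta b v : 0 <= sin_half eta b v <= 1.
Proof.
have := sin_geN1 (eta * (v - b)); have := sin_le1 (eta * (v - b)).
by rewrite /sin_half => *; apply/andP; split; lra.
Qed.

Lemma trig_step n eta b : trig_poly (fun v => step_poly n (sin_half eta b v)).
Proof.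
apply: trig_exp.
have h : trig_poly (fun v => sin_half eta b v).
  apply: trig_ext (trig_add (trig_cst (1 / 2))
    (trig_scale (- (1 / 2)) (trig_cos eta (- (eta * b) - pi / 2)))) => v /=.
  by rewrite addrA cosBpihalf -mulrBr /sin_half; field.
by apply: trig_ext (trig_add (trig_cst 1) (trig_scale (-1) (trig_exp n h))) => v /=;
  rewrite mulN1r.
Qed.

Section Zero.
Variable phi : R -> R.
Hypothesis phi_int : mu.-integrable pos (EFin \o phi).

Let mphi : measurable_fun pos phi.
Proof. by apply/measurable_EFinP; exact: measurable_int phi_int. Qed.

Let orthogonal psi := mu.-integrable pos (fun x => (phi x * psi (ln x))%:E) /\
  (\int[mu]_(x in pos) (phi x * psi (ln x))%:E = 0)%E.

(* [phi] itself dominates, so bounded pointwise convergence is enough. *)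
Lemma orthogonal_limit (psi_ : (R -> R)^nat) psi :
  (forall n, orthogonal (psi_ n)) ->
  (forall n v, `|psi_ n v| <= 1) ->
  (forall v, psi_ n v @[n --> \oo] --> psi v) ->
  orthogonal psi.
Proof.
move=> o le1 cv.
have m n : measurable_fun pos (fun x => (phi x * psi_ n (ln x))%:E).
  by have [h _] := o n; exact: measurable_int h.
have ai : mu.-integrable pos (fun x => `|phi x|%:E).
  exact: integrable_norm phi_int.
have c x : pos x -> (phi x * psi_ n (ln x))%:E @[n --> \oo] --> (phi x * psi (ln x))%:E.
  by move=> _; apply: cvg_EFin; [exact: nearW|apply: cvgMr; exact: cv].
have dom n x : pos x -> (`|(phi x * psi_ n (ln x))%:E| <= `|phi x|%:E)%E.
  by move=> _; rewrite lee_fin normrM ler_piMr.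
have [||||||i _ l] := @dominated_convergence _ _ _ mu pos _
  (fun n x => (phi x * psi_ n (ln x))%:E) (fun x => (phi x * psi (ln x))%:E)
  (fun x => `|phi x|%:E).
- exact: measurable_itv.
- exact: m.
- by apply: emeasurable_fun_cvg; [exact: m|exact: c].
- by apply: aeW => x; exact: c.
- exact: ai.
- by apply: aeW => x n; exact: dom.
split => //.
suff : (\int[mu]_(x in pos) (phi x * psi_ n (ln x))%:E)%E @[n --> \oo] --> 0%E.
  by move=> /cvg_lim <- //; move/cvg_lim: l => <-.
by under eq_fun do rewrite (o _).2; exact: cvg_cst.
Qed.

Lemma orthogonal_scale k psi : orthogonal psi -> orthogonal (fun v => k * psi v).
Proof.
move=> [i e].
have E x : (phi x * (k * psi (ln x)))%:E = (k%:E * (phi x * psi (ln x))%:E)%E.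
  by rewrite -EFinM mulrCA.
split.
  have : mu.-integrable pos (fun x => k%:E * (phi x * psi (ln x))%:E)%E.
    exact: integrableZl.
  by apply: eq_integrable => // x _; rewrite E.
by under eq_integral do rewrite E; rewrite integralZl// e mule0.
Qed.

Lemma orthogonal_add p q : orthogonal p -> orthogonal q ->
  orthogonal (fun v => p v + q v).
Proof.
move=> [ip ep] [iq eq].
have E x : (phi x * (p (ln x) + q (ln x)))%:E =
    ((phi x * p (ln x))%:E + (phi x * q (ln x))%:E)%E.
  by rewrite -EFinD mulrDr.
split.
  have : mu.-integrable pos (fun x => (phi x * p (ln x))%:E + (phi x * q (ln x))%:E)%E.
    exact: integrableD.
  by apply: eq_integrable => // x _; rewrite E.
by under eq_integral do rewrite E; rewrite integralD// ep eq adde0.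
Qed.

Hypothesis phi_cos : forall a b,
  (\int[mu]_(x in pos) (phi x * cos (a * ln x + b))%:E = 0)%E.

Lemma orthogonal_trig p : trig_poly p -> orthogonal p.
Proof.
elim=> {p} [a b|p q _ op _ oq|k p _ op].
- split; last exact: phi_cos.
  apply: le_integrable phi_int => //.
    apply/measurable_EFinP; apply: measurable_funM => //.
    apply: measurable_funTS; apply: measurableT_comp.
      by apply: continuous_measurable_fun; exact: continuous_cos.
    by apply: measurable_funD => //; apply: measurable_funM => //; exact: measurable_ln.
  move=> x _; rewrite lee_fin normrM ler_piMr//.
  by rewrite ler_norml cos_geN1 cos_le1.
- exact: orthogonal_add.
- exact: orthogonal_scale.
Qed.

Lemma orthogonal_sin_half eta b :
  orthogonal (fun v => if sin_half eta b v < 1 / 2 then 1 else 0).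
Proof.
apply: (@orthogonal_limit (fun n v => step_poly n (sin_half eta b v))).
- by move=> n; exact/orthogonal_trig/trig_step.
- move=> n v; have /andP[h0 h1] := step_poly_itv n (sin_half_itv eta b v).
  by rewrite ger0_norm.
- by move=> v; exact/cvg_step_poly/sin_half_itv.
Qed.

(* sin (eta (v - b)) has the sign of v - b as soon as eta |v - b| < pi. *)
Lemma orthogonal_gt b : orthogonal (fun v => if b < v then 1 else 0).
Proof.
apply: (@orthogonal_limit (fun n v => if sin_half n.+1%:R^-1 b v < 1 / 2 then 1 else 0)).
- by move=> n; exact: orthogonal_sin_half.
- by move=> n v; case: ifP; rewrite ?normr1 ?normr0.
move=> v; apply: cvg_near_cst; near=> n.
congr (if _ then _ else _).
have n0 : 0 < n.+1%:R^-1 :> R by rewrite invr_gt0.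
have small : n.+1%:R^-1 * `|v - b| < pi.
  apply: (@le_lt_trans _ _ 1); last by apply: lt_le_trans (pi_ge2 _); rewrite ltr1n.
  rewrite mulrC ler_pdivrMr// mul1r (@le_trans _ _ n%:R) ?ler_nat//.
  by near: n; exact: nbhs_infty_ger.
have -> : (sin_half n.+1%:R^-1 b v < 1 / 2) = (0 < sin (n.+1%:R^-1 * (v - b))).
  by rewrite /sin_half; apply/idP/idP => h; lra.
case: (ltgtP b v) => bv.
- apply: sin_gt0_pi; rewrite mulr_gt0 ?subr_gt0//=.
  by move: small; rewrite ger0_norm// subr_ge0 ltW.
- apply/negbTE; rewrite -leNgt -oppr_ge0 -sinN ltW// sin_gt0_pi// -mulrN opprB.
  rewrite mulr_gt0 ?subr_gt0//=.
  by move: small; rewrite distrC ger0_norm// subr_ge0 ltW.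
- by rewrite bv subrr mulr0 sin0 ltxx.
Unshelve. all: by end_near. Qed.

(** If [phi x0] were nonzero, [phi] would keep its sign on an interval around x0, and the integral
    against the signed indicator of that interval would be positive. *)
Lemma orthogonal_eq0 : {in pos, continuous phi} -> {in pos, phi =1 cst 0}.
Proof.
move=> cphi x0 x0pos; apply/eqP; apply: contrapT => /negP phi0 /=.
have := x0pos; rewrite inE/= in_itv/= andbT => x00.
pose sphi x := Num.sg (phi x0) * phi x.
have sphi0 : 0 < sphi x0 by rewrite /sphi -normrEsg normr_gt0.
have : \forall x \near x0, 0 < sphi x.
  have : sphi x @[x --> x0] --> sphi x0 by apply: cvgMr; exact: cphi.
  by move/cvgr_gt; apply.
move=> /nbhs_ballP[r /= r0 rP].
(* The minimum with x0 keeps c positive, so that [ln c] is meaningful. *)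
pose c := x0 - Num.min r x0 / 2; pose d := x0 + r / 2.
have m0 : 0 < Num.min r x0 by rewrite lt_min r0.
have [mr mx] : Num.min r x0 <= r /\ Num.min r x0 <= x0 by rewrite !ge_min !lexx orbT.
have cd : [/\ 0 < c, c < x0 & x0 < d] by rewrite /c /d; split; lra.
have {cd} [c0 cx xd] := cd.
have cdP x : x \in `]c, d] -> 0 < sphi x.
  rewrite in_itv/= => /andP[cx' xd']; apply: rP; rewrite /ball/= ltr_norml.
  by move: cx' xd'; rewrite /c /d => *; apply/andP; split; lra.
(* In the variable ln x, the indicator of []c, d]] is a difference of two half-line indicators. *)
pose psi v := Num.sg (phi x0) * ((if ln c < v then 1 else 0) + -1 * (if ln d < v then 1 else 0)).
have [_] : orthogonal psi.
  apply: orthogonal_scale; apply: orthogonal_add; first exact: orthogonal_gt.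
  by apply: orthogonal_scale; exact: orthogonal_gt.
have -> : (\int[mu]_(x in pos) (phi x * psi (ln x))%:E = \int[mu]_(x in `]c, d]) (sphi x)%:E)%E.
  have -> : `]c, d]%classic = pos `&` `]c, d]%classic.
    rewrite setIidr// => x /=; rewrite !in_itv/= andbT => /andP[cx' _].
    exact: lt_trans cx'.
  rewrite integral_mkcondr; apply: eq_integral => x /set_mem /=.
  rewrite in_itv/= andbT => xp; rewrite patchE mem_setE in_itv/= /psi /sphi.
  have d0 : 0 < d by exact: lt_trans xd.
  rewrite !ltr_ln ?posrE//.
  case: (ltP c x) => cx'; case: (ltP d x) => dx' /=; congr EFin; try ring.
  by have := lt_trans (lt_trans cx xd) dx'; rewrite ltNge cx'.
move=> /eqP; rewrite gt_eqF// integral_gt0//.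
- apply/measurable_EFinP; apply: measurable_funM => //; apply: measurable_funS mphi => //.
  by move=> x /=; rewrite !in_itv/= andbT => /andP[cx' _]; exact: lt_trans cx'.
- have mcd : mu `]c, d]%classic != 0%E.
    rewrite lebesgue_measure_itv/= lte_fin (lt_trans cx)// -EFinB.
    by rewrite eqe subr_eq0 gt_eqF// (lt_trans cx).
  exact: mcd.
Qed.

End Zero.

End MellinUniqueness.

(** * The Meijer G-function and the weight *)

Section MeijerG.
Variable R : realType.
Local Notation mu := (@lebesgue_measure R).
Local Notation pos := (`]0%R, +oo[%classic : set R).
Local Open Scope complex_scope.
Implicit Types (nu x : R) (s : R[i]) (g : R -> R).

Lemma cpowM_real x s (r : R) : cpow x (s - 1) * r%:C =
  (cospow (complex.Re s) (complex.Im s) 0 x * r) +i*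
  (cospow (complex.Re s) (complex.Im s) (- (pi / 2)) x * r).
Proof.
case: s => a b; rewrite /cpow /cospow /= subr0 addr0 cosBpihalf.
by congr (_ +i* _); rewrite /=; ring.
Qed.

Lemma cGammaE s : cGamma s =
  mellin_expR (complex.Re s) (complex.Im s) 0 +i*
  mellin_expR (complex.Re s) (complex.Im s) (- (pi / 2)).
Proof.
rewrite /cGamma /cintegral /mellin_expR.
by congr (_ +i* _); apply: eq_Rintegral => x _; rewrite cpowM_real.
Qed.

Lemma is_meijerG2002_integral nu : -1 < nu -> is_meijerG2002 nu (meijer_integral nu).
Proof.
move=> nu1; split; first exact: continuous_meijer_integral.
move=> s; rewrite gt_max => /andP[s0 snu] f.
have snu0 : 0 < nu + complex.Re s by lra.
have i b := integrable_mellin_meijer s0 snu0 nu1 (complex.Im s) b.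
split.
  rewrite /f; split; [have := i 0|have := i (- (pi / 2))];
  by apply: eq_integrable => // x _; rewrite cpowM_real.
have -> : nu%:C + s = (nu + complex.Re s) +i* complex.Im s.
  by case: s {s0 snu f snu0 i} => a b; congr (_ +i* _); rewrite /= add0r.
have fE x : f x = (cospow (complex.Re s) (complex.Im s) 0 x * meijer_integral nu x) +i*
  (cospow (complex.Re s) (complex.Im s) (- (pi / 2)) x * meijer_integral nu x).
  exact: cpowM_real.
rewrite !cGammaE /cintegral.
under eq_Rintegral do rewrite fE/=.
under [X in _ +i* X]eq_Rintegral do rewrite fE/=.
rewrite !mellin_meijer// sub0r -opprD.
(* In the imaginary part the phase is lowered by a quarter turn twice; the resulting half turn is a
   change of sign. *)
have -> : - (pi / 2 + pi / 2) = 0 - pi :> R by field.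
rewrite (mellin_expRD _ 0 (- pi))// sinN sinpi cosN cospi oppr0 mul0r subr0 mulN1r.
rewrite [complex.Re (_ +i* _)]/= [complex.Im (_ +i* _)]/=.
move: (mellin_expR (nu + _) _ _) (mellin_expR (nu + _) _ 0).
move: (mellin_expR _ _ _) (mellin_expR _ _ 0) => A B C D.
by congr (_ +i* _); rewrite /=; ring.
Qed.

Lemma is_meijerG2002_unique nu g1 g2 :
  is_meijerG2002 nu g1 -> is_meijerG2002 nu g2 -> {in pos, g1 =1 g2}.
Proof.
move=> [c1 m1] [c2 m2].
(* Any abscissa in the half-plane of the definition would do; only this vertical line is used. *)
pose a : R := Num.max 0 (- nu) + 1.
have aM : Num.max 0 (- nu) < a by rewrite ltrDl.
(* An integral with arbitrary phase combines the real and imaginary parts of the transform, hence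
   depends on g only through the prescribed values. *)
have phase g b t : (forall s : R[i], Num.max 0 (- nu) < complex.Re s ->
    let f x := cpow x (s - 1) * (g x)%:C in
    cintegrable mu pos f /\
    cintegral mu pos f = cGamma s * cGamma (nu%:C + s)) ->
  mu.-integrable pos (fun x => (cospow a t b x * g x)%:E) /\
  (\int[mu]_(x in pos) (cospow a t b x * g x)%:E)%E =
  (cos b * complex.Re (cGamma (a +i* t) * cGamma (nu%:C + (a +i* t))) -
  sin b * complex.Im (cGamma (a +i* t) * cGamma (nu%:C + (a +i* t))))%:E.
  move=> /(_ (a +i* t) aM) [[iRe iIm] e].
  have {}iRe : mu.-integrable pos (fun x => (cospow a t 0 x * g x)%:E).
    by apply: eq_integrable iRe => // x _; rewrite cpowM_real.
  have {}iIm : mu.-integrable pos (fun x => (cospow a t (- (pi / 2)) x * g x)%:E).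
    by apply: eq_integrable iIm => // x _; rewrite cpowM_real.
  have E x : (cospow a t b x * g x)%:E = ((cos b)%:E * (cospow a t 0 x * g x)%:E -
    (sin b)%:E * (cospow a t (- (pi / 2)) x * g x)%:E)%E.
    rewrite -!EFinM -EFinB; congr EFin.
    by rewrite -[in LHS](add0r b) cospowD sub0r; ring.
  split.
    have : mu.-integrable pos (fun x => (cos b)%:E * (cospow a t 0 x * g x)%:E -
        (sin b)%:E * (cospow a t (- (pi / 2)) x * g x)%:E)%E.
      by apply: integrableB => //; exact: integrableZl.
    by apply: eq_integrable => // x _; rewrite E.
  have eR : complex.Re (cGamma (a +i* t) * cGamma (nu%:C + (a +i* t))) =
      (\int[mu]_(x in pos) (cospow a t 0 x * g x))%R.
    transitivity (\int[mu]_(x in pos) complex.Re (cpow x (a +i* t - 1) * (g x)%:C))%R.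
      by rewrite -e.
    by apply: eq_Rintegral => x _; rewrite cpowM_real.
  have eI : complex.Im (cGamma (a +i* t) * cGamma (nu%:C + (a +i* t))) =
      (\int[mu]_(x in pos) (cospow a t (- (pi / 2)) x * g x))%R.
    transitivity (\int[mu]_(x in pos) complex.Im (cpow x (a +i* t - 1) * (g x)%:C))%R.
      by rewrite -e.
    by apply: eq_Rintegral => x _; rewrite cpowM_real.
  under eq_integral do rewrite E.
  rewrite integralB//; [|exact: integrableZl..].
  rewrite !integralZl// eR eI EFinB !EFinM /Rintegral.
  by rewrite !fineK//; apply: integrable_fin_num.
pose h x := g1 x - g2 x.
(* The power x^(a-1) makes the difference integrable, as the orthogonality argument demands, and
   being nonzero it can be cancelled at the end. *)
pose phi x := cospow a 0 0 x * h x.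
have phase_h b t : mu.-integrable pos (fun x => (cospow a t b x * h x)%:E) /\
  (\int[mu]_(x in pos) (cospow a t b x * h x)%:E = 0)%E.
  have [i1 e1] := phase g1 b t m1; have [i2 e2] := phase g2 b t m2.
  have E x : (cospow a t b x * h x)%:E =
    ((cospow a t b x * g1 x)%:E - (cospow a t b x * g2 x)%:E)%E.
    by rewrite -EFinB -mulrBr.
  split.
    by apply: eq_integrable (integrableB _ i1 i2) => // x _; rewrite E.
  under eq_integral do rewrite E.
  by rewrite integralB// e1 e2 subee.
have phi0 : {in pos, phi =1 cst 0}.
  apply: orthogonal_eq0.
  - exact: (phase_h 0 0).1.
  - move=> t b; rewrite -[RHS](phase_h b t).2; apply: eq_integral => x _.
    by rewrite /phi cospow00 /cospow mulrAC.
  - move=> x xp; have := xp; rewrite inE/= in_itv/= andbT => x0.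
    rewrite (_ : phi = fun x => x `^ (a - 1) * h x); last first.
      by apply/funext => y; rewrite /phi cospow00.
    have cp : {for x, continuous (fun x : R => x `^ (a - 1))}.
      have ? := is_derive1_powR (a - 1) x0.
      apply: differentiable_continuous; apply/derivable1_diffP; exact: ex_derive.
    apply: cvgM; first exact: cp.
    by apply: cvgB; [exact: c1|exact: c2].
move=> x xp; have := xp; rewrite inE/= in_itv/= andbT => x0.
have /eqP := phi0 x xp; rewrite /phi cospow00 mulf_eq0 gt_eqF ?powR_gt0//=.
by rewrite subr_eq0 => /eqP.
Qed.

(** Existence ensures that the value chosen by [get] has the defining property; uniqueness then
    identifies it on the half-line. *)
Lemma meijerG2002E nu : -1 < nu -> {in pos, meijerG2002 nu =1 meijer_integral nu}.
Proof.
move=> nu1; apply: (@is_meijerG2002_unique nu); last exact: is_meijerG2002_integral.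
by apply: getPex; exists (meijer_integral nu); exact: is_meijerG2002_integral.
Qed.

Lemma weight_componentE nu r : -1 < nu -> 0 < r ->
  weight_component nu r = (4 * Gamma (nu + 1))^-1 * meijer_integral nu (r ^+ 2 / 4).
Proof.
move=> nu1 r0; rewrite /weight_component meijerG2002E// inE/= in_itv/= andbT.
by rewrite divr_gt0// exprn_gt0.
Qed.

(** Confined to positive r, since the G-function is prescribed only at positive arguments. *)
Lemma weight_component_gt0 nu r : -1 < nu -> 0 < r -> 0 < weight_component nu r.
Proof.
move=> nu1 r0; rewrite weight_componentE// mulr_gt0//.
  by rewrite invr_gt0 mulr_gt0// Gamma_gt0//; lra.
by rewrite meijer_integral_gt0// divr_gt0// exprn_gt0.
Qed.

Lemma measurable_meijer_integral nu : -1 < nu -> measurable_fun pos (meijer_integral nu).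
Proof.
move=> nu1; apply: open_continuous_measurable_fun; first exact: interval_open.
exact: continuous_meijer_integral.
Qed.

Lemma measurable_weight_component nu : -1 < nu ->
  measurable_fun pos (fun y => weight_component nu (Num.sqrt y)).
Proof.
move=> nu1; have q0 : 0 < (4^-1 : R) by rewrite invr_gt0.
apply: (eq_measurable_fun (fun y : R => (4 * Gamma (nu + 1))^-1 * meijer_integral nu (4^-1 * y))).
  move=> y /set_mem /=; rewrite in_itv/= andbT => y0.
  have s0 : 0 < Num.sqrt y by rewrite sqrtr_gt0.
  by rewrite (weight_componentE nu1 s0) (sqr_sqrtr (ltW y0)) [y / 4]mulrC.
apply: measurable_funM => //; apply/measurable_EFinP.
apply: (@measurable_scale _ 4^-1 (fun x => (meijer_integral nu x)%:E)) => //.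
by apply/measurable_EFinP; exact: measurable_meijer_integral.
Qed.

Lemma moment_meijer_integral nu n : -1 < nu ->
  mu.-integrable pos (fun x => (x ^+ n * meijer_integral nu x)%:E) /\
  (\int[mu]_(x in pos) (x ^+ n * meijer_integral nu x)%:E)%E =
  (Gamma (n%:R + 1) * Gamma (nu + n%:R + 1))%:E.
Proof.
move=> nu1; have s0 : 0 < n%:R + 1 :> R by rewrite ltr_wpDl.
have snu0 : 0 < nu + (n%:R + 1) by rewrite addrCA ltr_wpDl//; lra.
have i := integrable_mellin_meijer s0 snu0 nu1 0 0.
have E x : pos x -> cospow (n%:R + 1) 0 0 x = x ^+ n.
  by rewrite /= in_itv/= andbT => x0; rewrite cospow00 addrK powR_mulrn// ltW.
split.
  by apply: eq_integrable i => // x /set_mem xp; rewrite E.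
transitivity (\int[mu]_(x in pos) (cospow (n%:R + 1) 0 0 x * meijer_integral nu x)%:E)%E.
  by apply: eq_integral => x /set_mem xp; rewrite E.
rewrite -[LHS]fineK ?integrable_fin_num//; congr EFin.
rewrite -[LHS]/(\int[mu]_(x in pos) (cospow (n%:R + 1) 0 0 x * meijer_integral nu x))%R.
rewrite mellin_meijer// !mellin_expR00 addrA.
(* At frequency 0 the quarter-turned phase has cosine 0: this is the imaginary part of the real
   number Gamma(n + 1). *)
have -> : mellin_expR (n%:R + 1) 0 (- (pi / 2)) = 0 :> R.
  rewrite /mellin_expR /Rintegral integral0_eq// => x _.
  by rewrite /cospow mul0r add0r cosN cos_pihalf mulr0 mul0r.
by rewrite mul0r subr0.
Qed.

(** Substitute x = y / 4: the measure contributes a 4 that cancels the one in the weight, and y^n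
    contributes the 4^n of rho. *)
Lemma moment_weight_component nu n : -1 < nu ->
  (\int[mu]_(y in pos) (y ^+ n * weight_component nu (Num.sqrt y))%:E)%E =
  (rho_component nu n)%:E.
Proof.
move=> nu1; have q0 : 0 < (4^-1 : R) by rewrite invr_gt0.
have [i e] := moment_meijer_integral n nu1.
have := integral_scale q0 i; rewrite [LHS]e => h.
have G0 : 0 < Gamma (nu + 1) by apply: Gamma_gt0; lra.
transitivity (\int[mu]_(y in pos) ((4 ^+ n / (4 * Gamma (nu + 1)))%:E *
    ((4^-1 * y) ^+ n * meijer_integral nu (4^-1 * y))%:E))%E.
  apply: eq_integral => y /set_mem /=; rewrite in_itv/= andbT => y0.
  have s0 : 0 < Num.sqrt y by rewrite sqrtr_gt0.
  rewrite (weight_componentE nu1 s0) (sqr_sqrtr (ltW y0)) [y / 4]mulrC -EFinM; congr EFin.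
  move: (meijer_integral _ _) (Gamma (nu + 1)) G0 => m G G0.
  by rewrite exprMn exprVn; field; rewrite expf_neq0//= gt_eqF.
rewrite integralZl//; last exact: (integrable_scale q0 i).
have {}h : (\int[mu]_(y in pos) ((4^-1 * y) ^+ n * meijer_integral nu (4^-1 * y))%:E =
    4%:E * (Gamma (n%:R + 1) * Gamma (nu + n%:R + 1))%:E)%E.
  by rewrite h muleA -EFinM divff// mul1e.
rewrite h -!EFinM; congr EFin; rewrite /rho_component.
move: (Gamma (nu + 1)) G0 (Gamma (n%:R + 1)) (Gamma (nu + n%:R + 1)) => G G0 G1 G2.
field.
by rewrite gt_eqF.
Qed.

End MeijerG.

(** * Hilbert spaces *)

Section RealNorm.
Variable R : realType.
Local Open Scope complex_scope.
Implicit Types w z : R[i].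

(** The norm of a space over [R[i]] takes values in [R[i]]; this reads it in [R], where the limits
    and integrals are computed. *)
Definition nrm (V : normedZmodType R[i]) (x : V) : R := complex.Re `|x|.

Lemma nrmE (V : normedZmodType R[i]) (x : V) : `|x| = (nrm x)%:C.
Proof. by rewrite /nrm RRe_real// normr_real. Qed.

Lemma nrm_ge0 (V : normedZmodType R[i]) (x : V) : 0 <= nrm x.
Proof. by rewrite -(@lecR R) -nrmE rmorph0 normr_ge0. Qed.

Lemma nrm0 (V : normedZmodType R[i]) : nrm (0 : V) = 0.
Proof. by rewrite /nrm normr0. Qed.

Lemma nrm_eq0 (V : normedZmodType R[i]) (x : V) : nrm x = 0 -> x = 0.
Proof. by move=> x0; apply/eqP; rewrite -normr_eq0 nrmE x0. Qed.

Lemma ler_nrmD (V : normedZmodType R[i]) (x y : V) : nrm (x + y) <= nrm x + nrm y.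
Proof. by rewrite -(@lecR R) rmorphD/= -!nrmE ler_normD. Qed.

Lemma nrmN (V : normedZmodType R[i]) (x : V) : nrm (- x) = nrm x.
Proof. by rewrite /nrm normrN. Qed.

Lemma nrmC (V : normedZmodType R[i]) (x y : V) : nrm (x - y) = nrm (y - x).
Proof. by rewrite -nrmN opprB. Qed.

Lemma ler_nrm_sum (V : normedZmodType R[i]) I (r : seq I) P (f : I -> V) :
  nrm (\sum_(i <- r | P i) f i) <= \sum_(i <- r | P i) nrm (f i).
Proof.
elim/big_ind2 : _ => [|x a y b xa yb|//]; first by rewrite nrm0.
by apply: le_trans (ler_nrmD _ _) _; exact: lerD.
Qed.

Lemma nrmM z w : nrm (z * w) = nrm z * nrm w.
Proof. by apply: complexI; rewrite rmorphM/= -!nrmE normrM. Qed.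

Lemma nrmX z n : nrm (z ^+ n) = nrm z ^+ n.
Proof. by apply: complexI; rewrite rmorphXn/= -!nrmE normrX. Qed.

Lemma nrmZ (V : normedModType R[i]) z (x : V) : nrm (z *: x) = nrm z * nrm x.
Proof. by apply: complexI; rewrite rmorphM/= -!nrmE normrZ. Qed.

Lemma nrm_real (x : R) : nrm x%:C = `|x|.
Proof. by rewrite /nrm normc_def/= expr0n/= addr0 sqrtr_sqr. Qed.

Lemma nrm_sqr z : nrm z ^+ 2 = complex.Re z ^+ 2 + complex.Im z ^+ 2.
Proof.
by rewrite /nrm normc_def/= sqr_sqrtr// addr_ge0// sqr_ge0.
Qed.

Lemma ler_Re_nrm z : `|complex.Re z| <= nrm z.
Proof. by rewrite -(@lecR R) -nrmE normc_ge_Re. Qed.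

Lemma ler_Im_nrm z : `|complex.Im z| <= nrm z.
Proof.
rewrite -ler_sqr ?nnegrE ?nrm_ge0// nrm_sqr real_normK ?num_real//.
by rewrite lerDr sqr_ge0.
Qed.

Lemma conjE z : z^* = conjc z.
Proof. by []. Qed.

Lemma nrm_conj z : nrm z^* = nrm z.
Proof. by rewrite /nrm norm_conjC. Qed.

Lemma cvg_nrmP (V : normedModType R[i]) (u : V^nat) (l : V) :
  u n @[n --> \oo] --> l <-> nrm (u n - l) @[n --> \oo] --> 0.
Proof.
split => [/cvgrPdist_lt ul|/cvgrPdist_lt ul]; apply/cvgrPdist_lt => e e0.
  have := ul e%:C; rewrite ltcR => /(_ e0); apply: filterS => n.
  by rewrite nrmE ltcR sub0r normrN ger0_norm ?nrm_ge0// nrmC.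
have eE : e = (complex.Re e)%:C by rewrite RRe_real// gtr0_real.
have e'0 : 0 < complex.Re e by rewrite -ltcR -eE.
have := ul _ e'0; apply: filterS => n.
by rewrite sub0r normrN ger0_norm ?nrm_ge0// nrmE eE ltcR nrmC.
Qed.

Lemma cvg_nrm (V : normedModType R[i]) (u : V^nat) (l : V) :
  u n @[n --> \oo] --> l -> nrm (u n) @[n --> \oo] --> nrm l.
Proof.
move=> /cvg_nrmP ul; apply/cvgrPdist_lt => e e0.
move/cvgrPdist_lt : ul => /(_ _ e0); apply: filterS => n.
rewrite sub0r normrN ger0_norm ?nrm_ge0//; apply: le_lt_trans.
rewrite ler_norml; apply/andP; split.
  rewrite lerNl opprB lerBlDr -[X in nrm X <= _](subrK l).
  exact: ler_nrmD.
by rewrite lerBlDr nrmC -[X in nrm X <= _](subrK (u n)) ler_nrmD.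
Qed.

Lemma cvg_Re (u : R[i]^nat) (l : R[i]) :
  nrm (u n - l) @[n --> \oo] --> 0 ->
  complex.Re (u n) @[n --> \oo] --> complex.Re l.
Proof.
move=> /cvgrPdist_lt ul; apply/cvgrPdist_lt => e e0.
have := ul _ e0; apply: filterS => n; rewrite sub0r normrN ger0_norm ?nrm_ge0//.
by apply: le_lt_trans; rewrite nrmC; apply: le_trans (ler_Re_nrm _); rewrite raddfB.
Qed.

Lemma cvg_Im (u : R[i]^nat) (l : R[i]) :
  nrm (u n - l) @[n --> \oo] --> 0 ->
  complex.Im (u n) @[n --> \oo] --> complex.Im l.
Proof.
move=> /cvgrPdist_lt ul; apply/cvgrPdist_lt => e e0.
have := ul _ e0; apply: filterS => n; rewrite sub0r normrN ger0_norm ?nrm_ge0//.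
by apply: le_lt_trans; rewrite nrmC; apply: le_trans (ler_Im_nrm _); rewrite raddfB.
Qed.

Lemma nrm_cvg_series (V : completeNormedModType R[i]) (u : V^nat) :
  cvgn (series (fun n => nrm (u n))) -> cvgn (series u).
Proof.
move=> cu; apply: cauchy_cvg; apply/cauchy_seriesP => e e0.
have eE : e = (complex.Re e)%:C by rewrite RRe_real// gtr0_real.
have e'0 : 0 < complex.Re e by rewrite -ltcR -eE.
have /cauchy_cvgP/cauchy_seriesP/(_ _ e'0) := cu.
apply: filterS => n; rewrite ger0_norm ?sumr_ge0// => [h|i _]; last exact: nrm_ge0.
by rewrite nrmE eE ltcR; apply: le_lt_trans h; exact: ler_nrm_sum.
Qed.

End RealNorm.

Section HilbertSpace.
Variables (R : realType) (H : hilbert R).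
Local Open Scope complex_scope.
Implicit Types (x y u v : H) (z : R[i]).

Lemma hdot_self x : hdot H x x = (nrm x ^+ 2)%:C.
Proof. by rewrite -hdot_norm nrmE rmorphXn. Qed.

Lemma hdotC x y : hdot H x y = (hdot H y x)^*.
Proof. by rewrite hermC expr0 mul1r. Qed.

Lemma hdotZr z x y : hdot H x (z *: y) = z^* * hdot H x y.
Proof. by rewrite linearZr_LR. Qed.

Lemma hdotZl z x y : hdot H (z *: x) y = z * hdot H x y.
Proof. by rewrite linearZl_LR. Qed.

Lemma nrm_sqrD x y : nrm (x + y) ^+ 2 =
  nrm x ^+ 2 + nrm y ^+ 2 + 2 * complex.Re (hdot H x y).
Proof.
apply: complexI; rewrite -hdot_self linearDl !linearDr/= !hdot_self (hdotC y x).
have E : (2 * complex.Re (hdot H x y))%:C = hdot H x y + (hdot H x y)^*%C.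
  by rewrite addcJ rmorphM rmorph_nat.
by rewrite conjE !rmorphD [X in _ = _ + X]E/=; ring.
Qed.

(** The vector |y|^2 x - <x, y> y is orthogonal to y, and its squared norm is |y|^2 (|x|^2 |y|^2 -
    |<x, y>|^2). *)
Lemma CauchySchwarz_hdot x y : nrm (hdot H x y) <= nrm x * nrm y.
Proof.
have [->|y0] := eqVneq y 0.
  by rewrite linear0r !nrm0 mulr0.
have ny0 : 0 < nrm y.
  by rewrite lt_neqAle nrm_ge0 andbT eq_sym; apply: contra y0 => /eqP/nrm_eq0 ->.
have ny : nrm y ^+ 2 != 0 by rewrite expf_neq0// gt_eqF.
pose d := hdot H x y.
have : 0 <= nrm ((nrm y ^+ 2)%:C *: x + (- d) *: y) ^+ 2 by rewrite sqr_ge0.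
rewrite nrm_sqrD !nrmZ hdotZl hdotZr -/d nrmN nrm_real.
have -> : (- d)^* * d = (- (nrm d ^+ 2))%:C.
  by rewrite rmorphN mulNr mulrC -normCK nrmE -rmorphXn rmorphN.
rewrite -rmorphM/= (ger0_norm (sqr_ge0 _)) => h.
have {h} h : 0 <= nrm y ^+ 2 * ((nrm x * nrm y) ^+ 2 - nrm d ^+ 2).
  by apply: le_trans h _; rewrite le_eqVlt; apply/orP; left; apply/eqP; ring.
rewrite -ler_sqr ?nnegrE ?mulr_ge0 ?nrm_ge0// -subr_ge0.
by move: h; rewrite pmulr_rge0// exprn_gt0.
Qed.

Lemma hdot_linear_seq (u : H^nat) x y : u n @[n --> \oo] --> x ->
  nrm (hdot H (u n) y - hdot H x y) @[n --> \oo] --> 0.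
Proof.
move=> /cvg_nrmP ux.
apply: (@squeeze_cvgr _ _ _ _ (cst 0) (fun n => nrm (u n - x) * nrm y)).
- by apply: nearW => n; rewrite nrm_ge0/= -linearBl CauchySchwarz_hdot.
- exact: cvg_cst.
- by rewrite -[X in _ --> X](mul0r (nrm y)); apply: cvgMl.
Qed.

Section Basis.
Variable b : nat -> H.
Hypothesis hb : orthonormal_basis b.

Lemma nrm_basis n : nrm (b n) = 1.
Proof.
have := hb.1 n n; rewrite hdot_self eqxx => /complexI h.
by apply/eqP; rewrite -(@pexpr_eq1 _ _ 2) ?nrm_ge0// h.
Qed.

Lemma nrm_sqr_sum (a : R[i]^nat) n :
  nrm (series (fun k => a k *: b k) n) ^+ 2 = series (fun k => nrm (a k) ^+ 2) n.
Proof.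
elim: n => [|n IH].
  by rewrite /series/= !big_geq// nrm0 expr0n.
rewrite !seriesSr nrm_sqrD IH nrmZ nrm_basis mulr1.
suff -> : hdot H (series (fun k => a k *: b k) n) (a n *: b n) = 0 by rewrite mulr0 addr0.
rewrite /series/= linear_sumlz big1_seq// => k; rewrite mem_index_iota => /andP[_ /andP[_ kn]].
by rewrite linearZl_LR linearZr_LR/= hb.1 ltn_eqF// !mulr0.
Qed.

(** Continuity of the norm along the basis expansion, with Pythagoras for the partial sums. *)
Lemma parseval x :
  series (fun n => nrm (hdot H x (b n)) ^+ 2) @ \oo --> nrm x ^+ 2.
Proof.
have /cvg_nrm h := hb.2 x.
rewrite (_ : series _ = (fun n => nrm (series (fun n => hdot H x (b n) *: b n) n) ^+ 2)).
  by apply: cvgM; exact: h.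
by apply/funext => n; rewrite nrm_sqr_sum.
Qed.

End Basis.

End HilbertSpace.

(** * Coherent states *)

Section Coefficients.
Variables (R : realType) (nu : R).
Hypothesis nu1 : -1 < nu.
Local Open Scope complex_scope.

Let nu10 : 0 < nu + 1.
Proof. by rewrite -ltrBlDr sub0r. Qed.

Let Gnu : 0 < Gamma (nu + 1).
Proof. exact: Gamma_gt0. Qed.

Let Gnun n : 0 < Gamma (nu + n%:R + 1).
Proof. by rewrite Gamma_gt0// addrAC ltr_pwDl. Qed.

Lemma rho_componentE n :
  rho_component nu n = 4 ^+ n * n`!%:R * Gamma (nu + n%:R + 1) / Gamma (nu + 1).
Proof. by rewrite /rho_component Gamma_nat. Qed.

Lemma rho_component_gt0 n : 0 < rho_component nu n.
Proof.
by rewrite rho_componentE divr_gt0// !mulr_gt0// ?exprn_gt0// ltr0n fact_gt0.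
Qed.

Lemma rho_component0 : rho_component nu 0 = 1.
Proof.
by rewrite rho_componentE expr0 fact0 !mul1r addr0 divff// gt_eqF.
Qed.

Lemma rho_component_growth (M : R) : 0 < M ->
  exists2 K, 0 < K & forall n, M ^+ n <= K * rho_component nu n.
Proof.
move=> M0.
pose K := Gamma (nu + 1) / (M `^ nu * expR (- (M + 1))).
have K0 : 0 < K by rewrite divr_gt0// mulr_gt0 ?powR_gt0 ?expR_gt0.
(* The summand 1 serves n = 0, where rho is 1 and the argument [nu + 1] may be too small for
   [Gamma_ge_powR]. *)
exists (K + 1); first by rewrite addr_gt0.
case=> [|n].
  by rewrite expr0 rho_component0 mulr1 lerDr ltW.
apply: (@le_trans _ _ (K * rho_component nu n.+1)); last first.
  by rewrite ler_wpM2r ?lerDl// ltW// rho_component_gt0.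
have s1 : 1 <= nu + n.+1%:R + 1 by rewrite lerDr -natr1 addrCA addr_ge0// ltW.
have h := Gamma_ge_powR s1 M0.
rewrite addrK powRD ?(gt_eqF M0) ?implybT// powR_mulrn ?(ltW M0)// in h.
rewrite rho_componentE /K.
have : 1 <= 4 ^+ n.+1 * n.+1`!%:R :> R.
  by rewrite -natrX -natrM ler1n muln_gt0 expn_gt0 fact_gt0.
move: (4 ^+ n.+1 * n.+1`!%:R) => f f1.
move: (Gamma (nu + n.+1%:R + 1)) h (Gnun n.+1) => G2 h G20.
move: (Gamma (nu + 1)) (Gnu) => G1 G10.
have P0 : 0 < M `^ nu * expR (- (M + 1)) by rewrite mulr_gt0 ?powR_gt0 ?expR_gt0.
have {}h : M ^+ n.+1 * (M `^ nu * expR (- (M + 1))) <= G2.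
  by rewrite mulrA [_ * M `^ nu]mulrC.
move: (M `^ nu * expR (- (M + 1))) P0 h => P P0 h.
have -> : G1 / P * (f * G2 / G1) = f * (G2 / P) by field; rewrite !gt_eqF.
apply: (@le_trans _ _ (G2 / P)); first by rewrite ler_pdivlMr.
by rewrite ler_peMl// divr_ge0// ltW.
Qed.

Definition fock_coef n : R := (Num.sqrt (rho_component nu n))^-1.

Lemma fock_coef_gt0 n : 0 < fock_coef n.
Proof. by rewrite invr_gt0 sqrtr_gt0 rho_component_gt0. Qed.

Lemma fock_coef_sqr n : fock_coef n ^+ 2 = (rho_component nu n)^-1.
Proof. by rewrite exprVn sqr_sqrtr// ltW// rho_component_gt0. Qed.

(** The growth of rho at M^2, after taking square roots. *)
Lemma fock_coef_growth (M : R) : 0 < M ->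
  exists2 K, 0 < K & forall n, M ^+ n * fock_coef n <= K.
Proof.
move=> M0; have [K K0 h] := rho_component_growth (exprn_gt0 2 M0).
exists (Num.sqrt K) => [|n]; first by rewrite sqrtr_gt0.
rewrite ler_pdivrMr ?sqrtr_gt0 ?rho_component_gt0// -sqrtrM ?(ltW K0)//.
rewrite -[leLHS]ger0_norm ?exprn_ge0 ?(ltW M0)// -sqrtr_sqr ler_wsqrtr//.
by rewrite -exprM mulnC exprM.
Qed.

Lemma cvg_fock_coef_series (r : R) : 0 <= r ->
  cvgn (series (fun n => r ^+ n * fock_coef n)).
Proof.
(* Doubling r leaves a geometric majorant of ratio 1/2; the added 1 keeps the base positive when r =
   0. *)
move=> r0; have M0 : 0 < 2 * r + 1 by rewrite ltr_wpDl// mulr_ge0.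
have [K K0 h] := fock_coef_growth M0.
apply: (@series_le_cvg _ _ (geometric K 2^-1)).
- by move=> n; rewrite mulr_ge0 ?exprn_ge0// ltW// fock_coef_gt0.
- by move=> n; rewrite mulr_ge0 ?exprn_ge0 ?ltW.
- move=> n /=; apply: le_trans (ler_wpM2r _ (h n)); last by rewrite exprn_ge0.
  rewrite mulrAC ler_wpM2r ?(ltW (fock_coef_gt0 _))// -exprMn lerXn2r ?nnegrE//.
    by rewrite mulr_ge0// ltW.
  by lra.
- by apply: is_cvg_geometric_series; rewrite ger0_norm//; lra.
Qed.

Lemma norm_componentE y :
  norm_component nu y = limn (series (fun n => y ^+ n * fock_coef n ^+ 2)).
Proof.
congr (limn (series _)); apply/funext => n.
rewrite fock_coef_sqr rho_componentE; field.
by rewrite !gt_eqF// ?exprn_gt0// ltr0n fact_gt0.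
Qed.

End Coefficients.

Section FockVector.
Variables (R : realType) (nu : R) (H : hilbert R) (b : nat -> H).
Hypotheses (nu1 : -1 < nu) (hb : orthonormal_basis b).
Local Open Scope complex_scope.
Implicit Types z w : R[i].

Definition fock_term z n : H := (z ^+ n * (fock_coef nu n)%:C) *: b n.

Definition fock_vector z : H := limn (series (fock_term z)).

Lemma nrm_fock_term z n : nrm (fock_term z n) = nrm z ^+ n * fock_coef nu n.
Proof.
rewrite nrmZ nrm_basis// mulr1 nrmM nrmX nrm_real ger0_norm//.
exact/ltW/fock_coef_gt0.
Qed.

Lemma cvg_fock_vector z : series (fock_term z) @ \oo --> fock_vector z.
Proof.
apply: nrm_cvg_series; under eq_fun do rewrite nrm_fock_term.
exact/cvg_fock_coef_series/nrm_ge0.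
Qed.

Lemma nrm_fock_vector z :
  nrm (fock_vector z) ^+ 2 = norm_component nu (nrm z ^+ 2).
Proof.
rewrite norm_componentE//; apply/esym/cvg_lim => //.
have := cvg_nrm (@cvg_fock_vector z).
rewrite (_ : series _ = (fun n => nrm (series (fock_term z) n) ^+ 2)).
  by move=> h; apply: cvgM; exact: h.
apply/funext => n; rewrite nrm_sqr_sum//; congr (series _ n); apply/funext => k.
rewrite nrmM nrmX nrm_real ger0_norm; last exact/ltW/fock_coef_gt0.
by rewrite [RHS]exprMn -!exprM mulnC.
Qed.

(** The term n = 0 alone contributes 1, as rho(0) = 1. This lower bound makes the normalization
    harmless for continuity. *)
Lemma nrm_fock_vector_ge1 z : 1 <= nrm (fock_vector z).
Proof.
rewrite -(@ler_pXn2r _ 2) ?nnegrE ?nrm_ge0// expr1n.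
have h : nrm (series (fock_term z) n) ^+ 2 @[n --> \oo] --> nrm (fock_vector z) ^+ 2.
  by have h := cvg_nrm (@cvg_fock_vector z); apply: cvgM; exact: h.
apply: (cvgr_to_ge h); exists 1%N => // n /= n1.
rewrite nrm_sqr_sum// /series/= (big_ltn n1) expr0 mul1r nrm_real.
rewrite /fock_coef rho_component0// sqrtr1 invr1 normr1 expr1n lerDl.
by apply: sumr_ge0 => i _; exact: sqr_ge0.
Qed.

Definition ket_component z : H :=
  ((Num.sqrt (norm_component nu (nrm z ^+ 2)))^-1)%:C *: fock_vector z.

Lemma ket_componentE z :
  ket_component z = ((nrm (fock_vector z))^-1)%:C *: fock_vector z.
Proof. by rewrite /ket_component -nrm_fock_vector sqrtr_sqr ger0_norm ?nrm_ge0. Qed.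

Lemma nrm_ket_component z : nrm (ket_component z) = 1.
Proof.
have h : 0 < nrm (fock_vector z) by exact: lt_le_trans (nrm_fock_vector_ge1 z).
by rewrite ket_componentE nrmZ nrm_real ger0_norm ?invr_ge0 ?nrm_ge0// mulVf// gt_eqF.
Qed.

Lemma nrm_subrX z w (M : R) n : 1 <= M -> nrm z <= M -> nrm w <= M ->
  nrm (z ^+ n - w ^+ n) <= nrm (z - w) * (n%:R * M ^+ n).
Proof.
move=> M1 zM wM; have M0 : 0 <= M by rewrite (le_trans _ M1).
elim: n => [|n IH]; first by rewrite !expr0 subrr nrm0 mul0r mulr0.
have -> : z ^+ n.+1 - w ^+ n.+1 = z * (z ^+ n - w ^+ n) + (z - w) * w ^+ n.
  by rewrite !exprS; ring.
apply: le_trans (ler_nrmD _ _) _; rewrite !nrmM nrmX.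
apply: (@le_trans _ _ (M * (nrm (z - w) * (n%:R * M ^+ n)) + nrm (z - w) * M ^+ n.+1)).
  apply: lerD; first by apply: ler_pM => //; exact: nrm_ge0.
  apply: ler_wpM2l; first exact: nrm_ge0.
  apply: (@le_trans _ _ (M ^+ n)); first by rewrite lerXn2r ?nnegrE ?nrm_ge0.
  by rewrite exprS ler_peMl// exprn_ge0.
by rewrite le_eqVlt; apply/orP; left; apply/eqP; rewrite -natr1 exprS; ring.
Qed.

Lemma fock_vector_lipschitz (M : R) : 1 <= M ->
  exists2 L, 0 < L & forall z w, nrm z <= M -> nrm w <= M ->
    nrm (fock_vector z - fock_vector w) <= L * nrm (z - w).
Proof.
move=> M1; have M0 : 0 < M by rewrite (lt_le_trans _ M1).
(* The 4 is 2 times 2: one factor 2^k absorbs the k from differentiating z^k, the other leaves a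
   geometric series of ratio 1/2, whose sum explains the constant 2K. *)
have [K K0 h] := fock_coef_growth nu1 (mulr_gt0 (ltr0n R 4) M0).
exists (K * 2) => [|z w zM wM]; first by rewrite mulr_gt0.
have c : nrm (series (fock_term z) n - series (fock_term w) n) @[n --> \oo] -->
    nrm (fock_vector z - fock_vector w).
  by apply: cvg_nrm; apply: cvgB; exact: cvg_fock_vector.
apply: (cvgr_to_le c); apply: nearW => n.
rewrite /series/= -sumrB; apply: le_trans (ler_nrm_sum _ _ _) _.
apply: (@le_trans _ _ (\sum_(0 <= k < n) nrm (z - w) * geometric K 2^-1 k)).
  apply: ler_sum => k _.
  rewrite /fock_term -scalerBl -mulrBl nrmZ nrm_basis// mulr1 nrmM nrm_real.
  rewrite (ger0_norm (ltW (fock_coef_gt0 nu1 k))).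
  apply: (le_trans (ler_wpM2r (ltW (fock_coef_gt0 nu1 k)) (nrm_subrX k M1 zM wM))).
  rewrite -mulrA; apply: ler_wpM2l; first exact: nrm_ge0.
  rewrite /= exprVn ler_pdivlMr ?exprn_gt0//; apply: le_trans (h k).
  have -> : k%:R * M ^+ k * fock_coef nu k * 2 ^+ k =
    k%:R * 2 ^+ k * M ^+ k * fock_coef nu k by ring.
  rewrite ler_wpM2r ?(ltW (fock_coef_gt0 nu1 k))// exprMn ler_wpM2r ?exprn_ge0 ?(ltW M0)//.
  have -> : 4 ^+ k = 2 ^+ k * 2 ^+ k :> R by rewrite -exprMn -natrM.
  by rewrite ler_wpM2r ?exprn_ge0// -natrX ler_nat ltnW// ltn_expl.
rewrite -mulr_sumr [leRHS]mulrC ler_wpM2l ?nrm_ge0//.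
apply: le_trans (geometric_le_lim n (ltW K0) _ _) _ => //.
  by rewrite ger0_norm//; lra.
by rewrite le_eqVlt; apply/orP; left; apply/eqP; field.
Qed.

(** The difference splits into (1/|u| - 1/|v|) u and (u - v) / |v|; each has norm at most |u - v|
    because |v| >= 1. *)
Lemma nrm_normalize_sub (u v : H) : 0 < nrm u -> 1 <= nrm v ->
  nrm ((nrm u)^-1%:C *: u - (nrm v)^-1%:C *: v) <= 2 * nrm (u - v).
Proof.
move=> u0 v1; have v0 : 0 < nrm v by rewrite (lt_le_trans _ v1).
have -> : (nrm u)^-1%:C *: u - (nrm v)^-1%:C *: v =
    ((nrm u)^-1 - (nrm v)^-1)%:C *: u + (nrm v)^-1%:C *: (u - v).
  by rewrite rmorphB/= scalerBl scalerBr addrA subrK.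
apply: le_trans (ler_nrmD _ _) _; rewrite !nrmZ !nrm_real.
rewrite [`|(nrm v)^-1|]ger0_norm ?invr_ge0 ?nrm_ge0//.
have vi : (nrm v)^-1 <= 1 by rewrite invf_le1.
have uv0 := nrm_ge0 (u - v).
have h2 : (nrm v)^-1 * nrm (u - v) <= nrm (u - v) by rewrite ler_piMl.
have h1 : `|(nrm u)^-1 - (nrm v)^-1| * nrm u <= nrm (u - v).
  have -> : (nrm u)^-1 - (nrm v)^-1 = (nrm v - nrm u) / (nrm u * nrm v).
    by field; rewrite !gt_eqF.
  rewrite normrM normfV [`|nrm u * nrm v|]ger0_norm ?mulr_ge0 ?nrm_ge0//.
  have -> : `|nrm v - nrm u| / (nrm u * nrm v) * nrm u = (nrm v)^-1 * `|nrm v - nrm u|.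
    by field; rewrite !gt_eqF.
  apply: le_trans h2; rewrite ler_wpM2l ?invr_ge0 ?nrm_ge0//.
  rewrite ler_norml; apply/andP; split.
    rewrite lerNl opprB lerBlDr -[X in nrm X <= _](subrK v).
    exact: ler_nrmD.
  by rewrite lerBlDr nrmC -[X in nrm X <= _](subrK u) ler_nrmD.
by rewrite mulr_natl mulr2n lerD.
Qed.

Lemma ket_component_continuous z (e : R) : 0 < e ->
  exists2 d, 0 < d & forall w, nrm (w - z) < d ->
    nrm (ket_component w - ket_component z) < e.
Proof.
move=> e0.
have M1 : 1 <= nrm z + 1 by rewrite lerDr nrm_ge0.
have [L L0 hL] := fock_vector_lipschitz M1.
(* The 1 keeps w in the ball where L is a Lipschitz constant; the 2 is the cost of normalizing. *)
exists (Num.min 1 (e / (2 * L))) => [|w].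
  by rewrite lt_min ltr01 divr_gt0// mulr_gt0.
rewrite lt_min => /andP[w1 we].
have wM : nrm w <= nrm z + 1.
  by rewrite -[X in nrm X <= _](subrK z) addrC (le_trans (ler_nrmD _ _))// lerD2l ltW.
have zM : nrm z <= nrm z + 1 by rewrite lerDl.
have f1 v : 0 < nrm (fock_vector v) by exact: lt_le_trans (nrm_fock_vector_ge1 v).
rewrite !ket_componentE.
apply: le_lt_trans (nrm_normalize_sub (f1 w) (nrm_fock_vector_ge1 z)) _.
apply: (@le_lt_trans _ _ (2 * (L * nrm (w - z)))); first by rewrite ler_wpM2l// hL.
by rewrite mulrA mulrC -ltr_pdivlMr// mulr_gt0.
Qed.

End FockVector.

(** * Parseval on circles *)

Section CircleMean.
Variable R : realType.
Local Notation mu := (@lebesgue_measure R).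
Local Notation circle := (`[0%R, (2 * pi)%R[%classic : set R).

Lemma measurable_trig_poly p D : trig_poly p -> measurable_fun D (p : R -> R).
Proof.
move=> tp; apply: measurable_funTS; elim: tp => {p} [a b|p q _ mp _ mq|k p _ mp].
- apply: measurableT_comp; first by apply: continuous_measurable_fun; exact: continuous_cos.
  by apply: measurable_funD => //; apply: measurable_funM.
- exact: measurable_funD.
- exact: measurable_funM.
Qed.

Lemma bounded_trig_poly p : trig_poly p -> exists M, forall v, `|p v : R| <= M.
Proof.
elim=> {p} [a b|p q _ [M hM] _ [N hN]|k p _ [M hM]].
- by exists 1 => v; rewrite ler_norml cos_geN1 cos_le1.
- by exists (M + N) => v; apply: le_trans (ler_normD _ _) _; exact: lerD.
- by exists (`|k| * M) => v; rewrite normrM ler_wpM2l.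
Qed.

Lemma circle_measure : mu circle = (2 * pi)%:E.
Proof.
have p0 : 0 < 2 * pi :> R by rewrite mulr_gt0// pi_gt0.
by rewrite lebesgue_measure_itv/= lte_fin p0 -EFinB subr0.
Qed.

Lemma integrable_trig_poly p : trig_poly p ->
  mu.-integrable circle (fun v => (p v : R)%:E).
Proof.
move=> tp; have [M hM] := bounded_trig_poly tp.
apply: measurable_bounded_integrable => //.
- by have h : (mu circle < +oo)%E by rewrite circle_measure ltry.
- exact: measurable_trig_poly.
- exists M; split; first exact: num_real.
  by move=> x Mx v _ /=; apply: le_trans (hM v) _; exact: ltW.
Qed.

Definition circle_integral (p : R -> R) : R := (\int[mu]_(v in circle) p v)%R.

Lemma circle_integralD p q : trig_poly p -> trig_poly q ->
  circle_integral (fun v => p v + q v) = circle_integral p + circle_integral q.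
Proof. by move=> tp tq; apply: RintegralD => //; exact: integrable_trig_poly. Qed.

Lemma circle_integralZ k p : trig_poly p ->
  circle_integral (fun v => k * p v) = k * circle_integral p.
Proof. by move=> tp; apply: RintegralZl => //; exact: integrable_trig_poly. Qed.

Lemma circle_integral_cst k : circle_integral (fun=> k) = 2 * pi * k.
Proof.
transitivity (k * fine (mu circle)); first exact: Rintegral_cst.
by rewrite circle_measure mulrC.
Qed.

Lemma circle_integral_cos m b : (0 < m)%N ->
  circle_integral (fun v => cos (m%:R * v + b)) = 0.
Proof.
move=> m0; have m0R : m%:R != 0 :> R by rewrite pnatr_eq0 -lt0n.
have p0 : 0 < 2 * pi :> R by rewrite mulr_gt0// pi_gt0.
pose F (v : R) := m%:R^-1 * sin (m%:R * v + b).
have dF (v : R) : is_derive v 1 F (cos (m%:R * v + b)).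
  rewrite (_ : F = m%:R^-1 *: (sin \o ((m%:R *: id) + cst b)))//.
  apply: is_derive_eq; rewrite /GRing.scale/=.
  by rewrite !fctE/=; field.
have cF : continuous F.
  by move=> v; apply: differentiable_continuous; apply/derivable1_diffP; apply: ex_derive.
have cc : continuous (fun v : R => cos (m%:R * v + b)).
  move=> v; apply: continuous_comp; last exact: continuous_cos.
  by apply: cvgD; [apply: cvgMr; exact: cvg_id|exact: cvg_cst].
rewrite /circle_integral /Rintegral integral_itv_bndo_bndc; last first.
  by apply/measurable_EFinP; apply: measurable_funTS; exact: continuous_measurable_fun.
rewrite (@continuous_FTC2 _ _ F)//.
- rewrite -EFinB/= /F mulr0 add0r.
  have -> : m%:R * (2 * pi) + b = b + pi *+ 2 *+ m :> R.
    by rewrite -mulrnA -[pi *+ _]mulr_natl natrM; ring.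
  by rewrite (periodicn (@sinD2pi _)) subrr.
- exact: continuous_subspaceT.
- split.
  + by move=> v _; apply: ex_derive.
  + by apply: cvg_at_right_filter; exact: cF.
  + by apply: cvg_at_left_filter; exact: cF.
- by move=> v _; rewrite derive1E; apply: derive_val.
Qed.

End CircleMean.

Section CircleParseval.
Variable R : realType.
Local Notation mu := (@lebesgue_measure R).
Local Notation circle := (`[0%R, (2 * pi)%R[%classic : set R).
Local Open Scope complex_scope.
Implicit Types (y : R) (d : R[i]^nat) (w : R[i]).

Lemma polarX (theta y : R) n : polar theta y ^+ n =
  (Num.sqrt y ^+ n * cos (n%:R * theta)) +i* (Num.sqrt y ^+ n * sin (n%:R * theta)).
Proof.
elim: n => [|n IH]; first by rewrite !expr0 mul0r cos0 sin0 mulr1 mulr0.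
rewrite exprS IH /polar -natr1 mulrDl mul1r cosD sinD.
by congr (_ +i* _); rewrite /= exprS; ring.
Qed.

Lemma nrm_polar (theta y : R) : nrm (polar theta y) = Num.sqrt y.
Proof.
rewrite -[RHS]ger0_norm// -[RHS]sqrtr_sqr -[LHS]ger0_norm ?nrm_ge0// -sqrtr_sqr.
rewrite nrm_sqr/=; congr Num.sqrt.
by rewrite !exprMn -mulrDr cos2Dsin2 mulr1.
Qed.

Definition psum d n z : R[i] := series (fun k => z ^+ k * d k) n.

Lemma psumS d n z : psum d n.+1 z = psum d n z + z ^+ n * d n.
Proof. by rewrite /psum seriesSr. Qed.

Lemma nrm_sqr_add (w1 w2 : R[i]) : nrm (w1 + w2) ^+ 2 =
  nrm w1 ^+ 2 + nrm w2 ^+ 2 + 2 * complex.Re (w1 * conjc w2).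
Proof. by case: w1 w2 => [a b] [c e]; rewrite !nrm_sqr /=; ring. Qed.

Lemma Re_polar_mul theta y n m (w1 w2 : R[i]) : (n <= m)%N ->
  complex.Re (polar theta y ^+ n * w1 * conjc (polar theta y ^+ m * w2)) =
  Num.sqrt y ^+ (n + m) * complex.Re (w1 * conjc w2) * cos ((m - n)%:R * theta + 0) +
  Num.sqrt y ^+ (n + m) * complex.Im (w1 * conjc w2) * cos ((m - n)%:R * theta + - (pi / 2)).
Proof.
move=> nm; rewrite addr0 cosBpihalf natrB// mulrBl cosB sinB !polarX exprD.
by case: w1 w2 => [a b] [c e] /=; ring.
Qed.

(** Membership in [trig_poly] supplies the boundedness and measurability needed to split circle
    integrals. *)
Lemma trig_Re_psum d n y : trig_poly (fun t => complex.Re (psum d n (polar t y))).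
Proof.
elim: n => [|n IH]; first by apply: trig_ext (trig_cst 0) => t; rewrite /psum /series/= big_geq.
apply: trig_ext (trig_add IH
  (trig_add (trig_scale (Num.sqrt y ^+ n * complex.Re (d n)) (trig_cos n%:R 0))
     (trig_scale (- (Num.sqrt y ^+ n * complex.Im (d n))) (trig_cos n%:R (- (pi / 2)))))) => t /=.
rewrite psumS raddfD/= polarX; congr (_ + _).
by rewrite addr0 cosBpihalf; case: (d n) => a b /=; ring.
Qed.

Lemma trig_Im_psum d n y : trig_poly (fun t => complex.Im (psum d n (polar t y))).
Proof.
elim: n => [|n IH]; first by apply: trig_ext (trig_cst 0) => t; rewrite /psum /series/= big_geq.
apply: trig_ext (trig_add IH
  (trig_add (trig_scale (Num.sqrt y ^+ n * complex.Im (d n)) (trig_cos n%:R 0))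
     (trig_scale (Num.sqrt y ^+ n * complex.Re (d n)) (trig_cos n%:R (- (pi / 2)))))) => t /=.
rewrite psumS raddfD/= polarX; congr (_ + _).
by rewrite addr0 cosBpihalf; case: (d n) => a b /=; ring.
Qed.

Lemma trig_nrm_psum d n y : trig_poly (fun t => nrm (psum d n (polar t y)) ^+ 2).
Proof.
apply: trig_ext (trig_add (trig_exp 2 (trig_Re_psum d n y)) (trig_exp 2 (trig_Im_psum d n y))).
by move=> t; rewrite nrm_sqr.
Qed.

Lemma trig_Re_psum_mul d n m w y :
  trig_poly (fun t => complex.Re (psum d n (polar t y) * conjc (polar t y ^+ m * w))).
Proof.
apply: trig_ext (trig_add (trig_mul (trig_Re_psum d n y)
  (trig_add (trig_scale (Num.sqrt y ^+ m * complex.Re w) (trig_cos m%:R 0))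
     (trig_scale (- (Num.sqrt y ^+ m * complex.Im w)) (trig_cos m%:R (- (pi / 2))))))
  (trig_mul (trig_Im_psum d n y)
  (trig_add (trig_scale (Num.sqrt y ^+ m * complex.Im w) (trig_cos m%:R 0))
     (trig_scale (Num.sqrt y ^+ m * complex.Re w) (trig_cos m%:R (- (pi / 2))))))) => t /=.
rewrite polarX addr0 cosBpihalf.
by case: (psum _ _ _) w => [a b] [c e] /=; ring.
Qed.

(** Only powers k < n <= m meet z^m, so every frequency m - k is positive and integrates to 0 over a
    full turn. *)
Lemma circle_integral_psum_mul d n m w y : (n <= m)%N ->
  circle_integral (fun t => complex.Re (psum d n (polar t y) * conjc (polar t y ^+ m * w))) = 0.
Proof.
elim: n => [_|n IH nm].
  rewrite (_ : (fun _ => _) = (fun=> 0)) ?circle_integral_cst ?mulr0//.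
  by apply/funext => t; rewrite /psum /series/= big_geq// mul0r.
pose c1 := Num.sqrt y ^+ (n + m) * complex.Re (d n * conjc w).
pose c2 := Num.sqrt y ^+ (n + m) * complex.Im (d n * conjc w).
rewrite (_ : (fun _ => _) = (fun t =>
    complex.Re (psum d n (polar t y) * conjc (polar t y ^+ m * w)) +
    (c1 * cos ((m - n)%:R * t + 0) + c2 * cos ((m - n)%:R * t + - (pi / 2))))); last first.
  apply/funext => t; rewrite psumS mulrDl raddfD/=; congr (_ + _).
  by rewrite Re_polar_mul// ltnW.
have mn : (0 < m - n)%N by rewrite subn_gt0.
rewrite circle_integralD; [|exact: trig_Re_psum_mul|]; last first.
  by apply: trig_add; apply: trig_scale; exact: trig_cos.
rewrite IH ?(ltnW nm)// add0r circle_integralD; [|by apply: trig_scale; exact: trig_cos..].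
rewrite !circle_integralZ; [|exact: trig_cos..].
by rewrite !circle_integral_cos// !mulr0 addr0.
Qed.

Lemma circle_integral_nrm_psum d n y : 0 <= y ->
  circle_integral (fun t => nrm (psum d n (polar t y)) ^+ 2) =
  \sum_(0 <= k < n) 2 * pi * (y ^+ k * nrm (d k) ^+ 2).
Proof.
move=> y0; elim: n => [|n IH].
  rewrite big_geq// (_ : (fun _ => _) = (fun=> 0)) ?circle_integral_cst ?mulr0//.
  by apply/funext => t; rewrite /psum /series/= big_geq// nrm0 expr0n.
rewrite big_nat_recr//= -IH.
rewrite (_ : (fun _ => _) = (fun t => nrm (psum d n (polar t y)) ^+ 2 +
   (y ^+ n * nrm (d n) ^+ 2 +
    2 * complex.Re (psum d n (polar t y) * conjc (polar t y ^+ n * d n))))); last first.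
  apply/funext => t; rewrite psumS nrm_sqr_add -addrA; congr (_ + (_ + _)).
  by rewrite nrmM nrmX nrm_polar exprMn -exprM mulnC exprM sqr_sqrtr.
rewrite circle_integralD; [|exact: trig_nrm_psum|]; last first.
  by apply: trig_add; [exact: trig_cst|apply: trig_scale; exact: trig_Re_psum_mul].
rewrite circle_integralD; [|exact: trig_cst|by apply: trig_scale; exact: trig_Re_psum_mul].
rewrite (circle_integralZ 2 (trig_Re_psum_mul d n n (d n) y)).
by rewrite circle_integral_psum_mul// mulr0 addr0 circle_integral_cst.
Qed.

End CircleParseval.

(** * Resolution of unity *)

(* The inner integral may be infinite on a null set, where [fine] returns 0. *)
Lemma Rfubini12_in d1 d2 (T1 : measurableType d1) (T2 : measurableType d2)
    (R : realType) (m1 : {sigma_finite_measure set T1 -> \bar R})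
    (m2 : {sigma_finite_measure set T2 -> \bar R}) (D1 : set T1) (D2 : set T2)
    (f : T1 * T2 -> R) : measurable D1 -> measurable D2 ->
  (m1 \x m2)%E.-integrable (D1 `*` D2) (fun p => (f p)%:E) ->
  (\int[m1]_(x in D1) (\int[m2]_(y in D2) f (x, y)))%R =
  fine (\int[(m1 \x m2)%E]_(p in D1 `*` D2) (f p)%:E)%E.
Proof.
move=> mD1 mD2 fi; rewrite fubini12_in//; congr fine.
have gi := integrable_fubini12_in mD1 mD2 fi.
have mg := measurable_int _ gi.
apply: ae_eq_integral => //.
- by apply/measurable_EFinP; apply: measurableT_comp mg; exact: fine_measurable.
- have := integrable_ae mD1 gi; apply: filterS => x /= h Dx.
  by rewrite /Rintegral fineK// h.
Qed.

Section Resolution.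
Variables (R : realType) (nu : R) (H : hilbert R) (b : nat -> H).
Hypotheses (nu1 : -1 < nu) (hb : orthonormal_basis b).
Local Notation mu := (@lebesgue_measure R).
Local Notation pos := (`]0%R, +oo[%classic : set R).
Local Notation circle := (`[0%R, (2 * pi)%R[%classic : set R).
Local Open Scope complex_scope.
Implicit Types (x y u : H) (z : R[i]) (t r : R).

Local Notation S := (fock_vector nu b).

(** The power series coefficients of z -> <S(z)|u>, up to conjugation conventions. *)
Definition fock_coord u n : R[i] := (fock_coef nu n)%:C * hdot H (b n) u.

Lemma hdot_fock_series z u n :
  hdot H (series (fock_term nu b z) n) u = psum (fock_coord u) n z.
Proof.
rewrite /psum /series/= linear_sumlz; apply: eq_bigr => k _.
by rewrite linearZl_LR/= mulrA.
Qed.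

(** The n-th moment of the weight is rho(n), and it cancels the 1 / rho(n) hidden in the squared
    coefficient. *)
Lemma nrm_fock_coord u n : nrm (fock_coord u n) ^+ 2 * rho_component nu n =
  nrm (hdot H u (b n)) ^+ 2.
Proof.
rewrite /fock_coord nrmM nrm_real exprMn real_normK ?num_real// fock_coef_sqr//.
by rewrite mulrAC mulVf ?mul1r ?gt_eqF ?rho_component_gt0// hdotC nrm_conj.
Qed.

Definition fock_density u z : R := nrm (hdot H (S z) u) ^+ 2.

Lemma cvg_fock_density u z :
  nrm (psum (fock_coord u) n z) ^+ 2 @[n --> \oo] --> fock_density u z.
Proof.
have h : nrm (psum (fock_coord u) n z - hdot H (S z) u) @[n --> \oo] --> 0.
  under eq_fun do rewrite -hdot_fock_series.
  by apply: hdot_linear_seq; exact: cvg_fock_vector.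
rewrite /fock_density nrm_sqr; under eq_fun do rewrite nrm_sqr.
by apply: cvgD; apply: cvgM; [exact: cvg_Re|exact: cvg_Re|exact: cvg_Im|exact: cvg_Im].
Qed.

(** The bound depends on z only through its modulus, so it is a constant majorant on each circle. *)
Lemma nrm_psum_le u n z : nrm (psum (fock_coord u) n z) <=
  limn (series (fun k => nrm z ^+ k * fock_coef nu k)) * nrm u.
Proof.
rewrite -hdot_fock_series; apply: le_trans (CauchySchwarz_hdot _ _) _.
rewrite ler_wpM2r ?nrm_ge0//.
apply: (@le_trans _ _ (series (fun k => nrm z ^+ k * fock_coef nu k) n)).
  rewrite /series/=; apply: le_trans (ler_nrm_sum _ _ _) _.
  by apply: ler_sum => k _; rewrite nrm_fock_term.
apply: nondecreasing_cvgn_le; last exact/cvg_fock_coef_series/nrm_ge0.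
apply: nondecreasing_series => k _ _.
by rewrite mulr_ge0 ?exprn_ge0 ?nrm_ge0// ltW// fock_coef_gt0.
Qed.

Lemma measurable_Re_Im_psum d n (D : set (R * R)) :
  measurable_fun D (fun p : R * R => complex.Re (psum d n (polar p.1 p.2))) /\
  measurable_fun D (fun p : R * R => complex.Im (psum d n (polar p.1 p.2))).
Proof.
have m1 k (g : R -> R) : continuous g ->
  measurable_fun D (fun p : R * R => Num.sqrt p.2 ^+ k * g (k%:R * p.1)).
  move=> cg; apply: measurable_funM.
    apply: measurable_funX; apply: measurable_funTS.
    apply: (measurableT_comp (f := @Num.sqrt R)); last exact: measurable_snd.
    by apply: continuous_measurable_fun; exact: sqrt_continuous.
  apply: measurable_funTS; apply: measurableT_comp; first exact: continuous_measurable_fun.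
  by apply: measurable_funM => //; exact: measurable_fst.
elim: n => [|n [IHr IHi]].
  by split; rewrite (_ : (fun _ => _) = (fun=> 0))//; apply/funext => p;
    rewrite /psum /series/= big_geq.
split.
  rewrite (_ : (fun _ => _) = (fun p : R * R => complex.Re (psum d n (polar p.1 p.2)) +
    (Num.sqrt p.2 ^+ n * cos (n%:R * p.1) * complex.Re (d n) -
     Num.sqrt p.2 ^+ n * sin (n%:R * p.1) * complex.Im (d n)))); last first.
    by apply/funext => p; rewrite psumS raddfD/= polarX; case: (d n).
  apply: measurable_funD => //; apply: measurable_funB; apply: measurable_funM => //.
    by apply: m1; exact: continuous_cos.
  by apply: m1; exact: continuous_sin.
rewrite (_ : (fun _ => _) = (fun p : R * R => complex.Im (psum d n (polar p.1 p.2)) +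
    (Num.sqrt p.2 ^+ n * cos (n%:R * p.1) * complex.Im (d n) +
     Num.sqrt p.2 ^+ n * sin (n%:R * p.1) * complex.Re (d n)))); last first.
  by apply/funext => p; rewrite psumS raddfD/= polarX; case: (d n).
apply: measurable_funD => //; apply: measurable_funD; apply: measurable_funM => //.
  by apply: m1; exact: continuous_cos.
by apply: m1; exact: continuous_sin.
Qed.

Definition weighted_density u (p : R * R) : R :=
  weight_component nu (Num.sqrt p.2) * fock_density u (polar p.1 p.2).

Lemma measurable_weighted_density u :
  measurable_fun (circle `*` pos) (weighted_density u).
Proof.
apply: measurable_funM.
  apply: (measurable_comp (F := pos) (f := fun y : R => weight_component nu (Num.sqrt y))) => //.
  - by move=> _ [[s t] [_ /= tp] <-].
  - exact: measurable_weight_component.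
  - by apply: measurable_funTS; exact: measurable_snd.
apply: (measurable_fun_cvg (h := fun n p => nrm (psum (fock_coord u) n (polar p.1 p.2)) ^+ 2)).
  move=> n; rewrite (_ : (fun _ => _) = (fun p : R * R =>
    complex.Re (psum (fock_coord u) n (polar p.1 p.2)) ^+ 2 +
    complex.Im (psum (fock_coord u) n (polar p.1 p.2)) ^+ 2)); last first.
    by apply/funext => p; rewrite nrm_sqr.
  have [mR mI] := measurable_Re_Im_psum (fock_coord u) n (circle `*` pos).
  by apply: measurable_funD; apply: measurable_funX.
by move=> p _; exact: cvg_fock_density.
Qed.

Lemma weighted_density_ge0 u p : (circle `*` pos) p -> 0 <= weighted_density u p.
Proof.
move=> [_ /=]; rewrite in_itv/= andbT => p0.
rewrite mulr_ge0 ?sqr_ge0// ltW// weight_component_gt0// sqrtr_gt0//.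
Qed.

(** At a fixed angle the squared partial sums need not be monotone, so the limit is taken by
    dominated convergence. After averaging the terms are nonnegative, which prepares monotone
    convergence in the radial variable. *)
Lemma circle_fock_density u t : 0 < t ->
  (\int[mu]_(s in circle) (fock_density u (polar s t))%:E =
   \sum_(0 <= k <oo) (2 * pi * (t ^+ k * nrm (fock_coord u k) ^+ 2))%:E)%E.
Proof.
move=> t0.
pose B := limn (series (fun k => Num.sqrt t ^+ k * fock_coef nu k)) * nrm u.
have [] := @dominated_convergence _ _ _ mu circle _
  (fun n s => (nrm (psum (fock_coord u) n (polar s t)) ^+ 2)%:E)
  (fun s => (fock_density u (polar s t))%:E) (fun=> (B ^+ 2)%:E).
- exact: measurable_itv.
- by move=> n; apply/measurable_EFinP; apply: measurable_trig_poly; exact: trig_nrm_psum.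
- apply/measurable_EFinP.
  apply: (measurable_fun_cvg (h := fun n s => nrm (psum (fock_coord u) n (polar s t)) ^+ 2)).
    by move=> n; apply: measurable_trig_poly; exact: trig_nrm_psum.
  by move=> s _; exact: cvg_fock_density.
- by apply: aeW => s _; apply: cvg_EFin; [exact: nearW|exact: cvg_fock_density].
- exact: (integrable_trig_poly (trig_cst (B ^+ 2))).
- apply: aeW => s n _; rewrite lee_fin ger0_norm ?sqr_ge0//.
  rewrite lerXn2r ?nnegrE ?nrm_ge0//; last by rewrite /B -(nrm_polar s t) nrm_psum_le.
  (* The empty partial sum shows that B is nonnegative. *)
  by rewrite /B -(nrm_polar s t) (le_trans _ (nrm_psum_le u 0 _))// nrm_ge0.
move=> _ _ /cvg_lim <- //; congr (limn _); apply/funext => n /=.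
rewrite sumEFin -circle_integral_nrm_psum ?ltW//.
rewrite /circle_integral /Rintegral fineK//; apply: integrable_fin_num => //.
by apply: integrable_trig_poly; exact: trig_nrm_psum.
Qed.

Lemma integral_weighted_density u :
  (\int[(mu \x mu)%E]_(p in circle `*` pos) (weighted_density u p)%:E =
   (2 * pi * nrm u ^+ 2)%:E)%E.
Proof.
have p0 : 0 <= 2 * pi :> R by rewrite mulr_ge0// pi_ge0.
have pos_ge0 t : pos t -> 0 <= t by rewrite /= in_itv/= andbT => /ltW.
have W0 t : pos t -> 0 <= weight_component nu (Num.sqrt t).
  by rewrite /= in_itv/= andbT => t0; rewrite ltW// weight_component_gt0// sqrtr_gt0.
pose c k : R := 2 * pi * nrm (fock_coord u k) ^+ 2.
have c0 k : 0 <= c k by rewrite mulr_ge0 ?sqr_ge0.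
have mW : measurable_fun pos (fun t => weight_component nu (Num.sqrt t)).
  exact: measurable_weight_component.
rewrite tonelli21_in//; last 2 first.
- by apply/measurable_EFinP; exact: measurable_weighted_density.
- by move=> p Dp; rewrite lee_fin; exact: weighted_density_ge0.
transitivity (\int[mu]_(t in pos) \sum_(0 <= k <oo)
    ((c k)%:E * (t ^+ k * weight_component nu (Num.sqrt t))%:E))%E.
  apply: eq_integral => t /set_mem tp; have t0 : 0 < t.
    by move: tp; rewrite /= in_itv/= andbT.
  transitivity ((weight_component nu (Num.sqrt t))%:E *
      \int[mu]_(s in circle) (fock_density u (polar s t))%:E)%E.
    rewrite -ge0_integralZl//=.
    - apply/measurable_EFinP.
      apply: (measurable_fun_cvg (h := fun n s => nrm (psum (fock_coord u) n (polar s t)) ^+ 2)).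
        by move=> n; apply: measurable_trig_poly; exact: trig_nrm_psum.
      by move=> s _; exact: cvg_fock_density.
    - by move=> s _; rewrite lee_fin sqr_ge0.
    - by rewrite lee_fin W0.
  rewrite circle_fock_density// -nneseriesZl//; last first.
    by move=> k _; rewrite lee_fin !mulr_ge0 ?pi_ge0 ?exprn_ge0 ?nrm_ge0 ?(ltW t0).
  by apply: eq_eseriesr => k _; rewrite -!EFinM /c; congr EFin; ring.
rewrite integral_nneseries//; last 2 first.
- move=> k; apply: emeasurable_funM => //; apply/measurable_EFinP.
  by apply: measurable_funM => //; exact: exprn_measurable.
- move=> k t tp; rewrite -EFinM lee_fin mulr_ge0// mulr_ge0 ?exprn_ge0 ?(pos_ge0 _ tp)//.
  exact: W0.
transitivity (\sum_(0 <= k <oo) (2 * pi * nrm (hdot H u (b k)) ^+ 2)%:E)%E.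
  apply: eq_eseriesr => k _; rewrite ge0_integralZl//=.
  - rewrite moment_weight_component// -EFinM; congr EFin.
    by rewrite /c -[LHS]mulrA nrm_fock_coord.
  - by apply/measurable_EFinP; apply: measurable_funM.
  - move=> t tp; rewrite lee_fin mulr_ge0 ?exprn_ge0 ?(pos_ge0 _ tp)//.
    exact: W0.
  - by rewrite lee_fin.
apply/cvg_lim => //.
rewrite (_ : (fun _ => _) = (fun n => (2 * pi * series (fun k => nrm (hdot H u (b k)) ^+ 2) n)%:E)).
  by apply: cvg_EFin; [exact: nearW|apply: cvgMr; exact: parseval].
by apply/funext => n; rewrite sumEFin /series/= mulr_sumr.
Qed.

Lemma integrable_weighted_density u :
  (mu \x mu)%E.-integrable (circle `*` pos) (fun p => (weighted_density u p)%:E).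
Proof.
apply/integrableP; split.
  by apply/measurable_EFinP; exact: measurable_weighted_density.
rewrite (_ : integral _ _ _ = (2 * pi * nrm u ^+ 2)%:E) ?ltry//.
rewrite -integral_weighted_density; apply: eq_integral => p /set_mem Dp.
by rewrite gee0_abs// lee_fin weighted_density_ge0.
Qed.

(** Written with unnormalised vectors: the factor N of the weight cancels the two normalizations of
    the kets. *)
Definition resolution_integrand x y z : R[i] :=
  (weight_component nu (nrm z))%:C * (hdot H (S z) x * hdot H y (S z)).

Let polarization (p s : R[i]) :
  p * conjc s = (4^-1 * (nrm (p + s) ^+ 2 - nrm (p - s) ^+ 2)) +i*
    (4^-1 * (nrm (p + 'i%C * s) ^+ 2 - nrm (p - 'i%C * s) ^+ 2)).
Proof.
case: p s => [p1 p2] [s1 s2]; rewrite !nrm_sqr /=.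
by congr (_ +i* _); field.
Qed.

(** The second slot of [hdot] is conjugate linear, so adding i times the coordinate of y amounts to
    subtracting i y; hence the exchanged signs in the imaginary part. *)
Lemma resolution_integrandE x y (t r : R) : 0 < r ->
  resolution_integrand x y (polar t r) =
  (4^-1 * (weighted_density (x + y) (t, r) - weighted_density (x - y) (t, r))) +i*
  (4^-1 * (weighted_density (x - 'i%C *: y) (t, r) - weighted_density (x + 'i%C *: y) (t, r))).
Proof.
move=> r0; rewrite /resolution_integrand /weighted_density /fock_density nrm_polar/=.
have Dr (v w : H) : hdot H (S (polar t r)) (v + w) =
  hdot H (S (polar t r)) v + hdot H (S (polar t r)) w by rewrite linearDr.
have Br (v w : H) : hdot H (S (polar t r)) (v - w) =
  hdot H (S (polar t r)) v - hdot H (S (polar t r)) w by rewrite linearBr.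
have iZ (v w : H) : hdot H v ('i%C *: w) = - 'i%C * hdot H v w.
  by rewrite hdotZr; congr (_ * _); congr (_ +i* _); rewrite /= ?oppr0.
have -> : hdot H y (S (polar t r)) = conjc (hdot H (S (polar t r)) y) by exact: hdotC.
rewrite polarization !Br !Dr !iZ mulNr opprK.
by congr (_ +i* _); rewrite /=; ring.
Qed.

End Resolution.

Section ResolutionOfUnity.
Variables (R : realType) (nu : R) (H : hilbert R) (b : nat -> H).
Hypotheses (nu1 : -1 < nu) (hb : orthonormal_basis b).
Local Notation mu := (@lebesgue_measure R).
Local Notation pos := (`]0%R, +oo[%classic : set R).
Local Notation circle := (`[0%R, (2 * pi)%R[%classic : set R).
Local Open Scope complex_scope.
Implicit Types (x y u v : H) (z : R[i]).
Local Notation wd := (weighted_density nu b).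

Let integrable_wdB u v : (mu \x mu)%E.-integrable (circle `*` pos)
  (fun p => (4^-1 * (wd u p - wd v p))%:E).
Proof.
apply: integrableZl_EFin; first exact: measurableX.
have : (mu \x mu)%E.-integrable (circle `*` pos) (fun p => (wd u p)%:E - (wd v p)%:E)%E.
  by apply: integrableB; [exact: measurableX|exact: integrable_weighted_density..].
by apply: eq_integrable => //; exact: measurableX.
Qed.

Let integral_wdB u v :
  fine (\int[(mu \x mu)%E]_(p in circle `*` pos) (4^-1 * (wd u p - wd v p))%:E)%E =
  4^-1 * (2 * pi * nrm u ^+ 2 - 2 * pi * nrm v ^+ 2).
Proof.
have iu := integrable_weighted_density nu1 hb u.
have iv := integrable_weighted_density nu1 hb v.
have iB : (mu \x mu)%E.-integrable (circle `*` pos) (fun p => (wd u p - wd v p)%:E).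
  have : (mu \x mu)%E.-integrable (circle `*` pos) (fun p => (wd u p)%:E - (wd v p)%:E)%E.
    by apply: integrableB => //; exact: measurableX.
  by apply: eq_integrable => //; exact: measurableX.
transitivity (\int[(mu \x mu)%E]_(p in circle `*` pos) (4^-1 * (wd u p - wd v p)))%R.
  by [].
rewrite RintegralZl//; last exact: measurableX.
rewrite RintegralB//; last exact: measurableX.
by rewrite /Rintegral !integral_weighted_density.
Qed.

(** Each part is a quarter of a difference of two integrals of the form 2 pi |u|^2, and polarization
    in H reassembles the inner product. *)
Lemma resolution_of_unity x y :
  polar_integrable (resolution_integrand nu b x y) /\
  polar_integral (resolution_integrand nu b x y) = hdot H y x.
Proof.
have mD : measurable (circle `*` pos) by exact: measurableX.
set f := resolution_integrand nu b x y.
have fE (p : R * R) : (circle `*` pos) p -> f (polar p.1 p.2) =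
    (4^-1 * (wd (x + y) p - wd (x - y) p)) +i*
    (4^-1 * (wd (x - 'i%C *: y) p - wd (x + 'i%C *: y) p)).
  by case: p => t r [_ /=]; rewrite in_itv/= andbT; exact: resolution_integrandE.
have iR : (mu \x mu)%E.-integrable (circle `*` pos)
    (fun p => (complex.Re (f (polar p.1 p.2)))%:E).
  by apply: eq_integrable (integrable_wdB (x + y) (x - y)) => // p /set_mem Dp; rewrite fE.
have iI : (mu \x mu)%E.-integrable (circle `*` pos)
    (fun p => (complex.Im (f (polar p.1 p.2)))%:E).
  by apply: eq_integrable (integrable_wdB (x - 'i%C *: y) (x + 'i%C *: y)) => // p /set_mem Dp;
    rewrite fE.
split; first by split.
have p0 : pi != 0 :> R by rewrite gt_eqF// pi_gt0.
have eR : (\int[mu]_(t in circle) (\int[mu]_(r in pos) complex.Re (f (polar t r))))%R =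
    2 * pi * complex.Re (hdot H y x).
  transitivity (fine (\int[(mu \x mu)%E]_(p in circle `*` pos)
      (complex.Re (f (polar p.1 p.2)))%:E)%E).
    exact: (@Rfubini12_in _ _ _ _ R mu mu circle pos
      (fun p => complex.Re (f (polar p.1 p.2)))).
  transitivity (4^-1 * (2 * pi * nrm (x + y) ^+ 2 - 2 * pi * nrm (x - y) ^+ 2)).
    rewrite -integral_wdB; congr fine; apply: eq_integral => p /set_mem Dp.
    by rewrite fE.
  rewrite !nrm_sqrD nrmN linearNr raddfN/= [hdot H y x]hdotC.
  have -> : complex.Re (hdot H x y)^* = complex.Re (hdot H x y) by case: (hdot H x y).
  by field.
have eI : (\int[mu]_(t in circle) (\int[mu]_(r in pos) complex.Im (f (polar t r))))%R =
    2 * pi * complex.Im (hdot H y x).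
  transitivity (fine (\int[(mu \x mu)%E]_(p in circle `*` pos)
      (complex.Im (f (polar p.1 p.2)))%:E)%E).
    exact: (@Rfubini12_in _ _ _ _ R mu mu circle pos
      (fun p => complex.Im (f (polar p.1 p.2)))).
  transitivity (4^-1 * (2 * pi * nrm (x - 'i%C *: y) ^+ 2 - 2 * pi * nrm (x + 'i%C *: y) ^+ 2)).
    rewrite -integral_wdB; congr fine; apply: eq_integral => p /set_mem Dp.
    by rewrite fE.
  rewrite !nrm_sqrD nrmN linearNr raddfN/= [hdot H y x]hdotC hdotZr.
  have -> : complex.Re ('i%C^* * hdot H x y) = complex.Im (hdot H x y).
    by case: (hdot H x y) => p q /=; ring.
  have -> : complex.Im (hdot H x y)^* = - complex.Im (hdot H x y) by case: (hdot H x y).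
  by field.
rewrite /polar_integral /cintegral /= eR eI.
case: (hdot H y x) => p q /=.
by congr (_ +i* _); rewrite mul0r ?subr0 ?addr0 mulKf ?mulf_neq0.
Qed.

End ResolutionOfUnity.

(** * From components to bicomplex states *)

Section Components.
Variables (R : realType).
Local Open Scope complex_scope.
Implicit Types (V Z : bicomplex R) (nu : R) (z : R[i]).

Lemma sqrtC_real (a : R) : 0 <= a -> sqrtC a%:C = (Num.sqrt a)%:C.
Proof.
move=> a0; apply/eqP; rewrite -(@eqrXn2 _ 2)//.
- by rewrite sqrtCK -rmorphXn/= sqr_sqrtr.
- by rewrite sqrtC_ge0 -(rmorph0 (real_complex R)) lecR.
- by rewrite -(rmorph0 (real_complex R)) lecR sqrtr_ge0.
Qed.

Lemma pr1_hyp (a c : R) : pr1 (hyp a c) = a%:C. Proof. exact: pr1_idem. Qed.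

Lemma pr2_hyp (a c : R) : pr2 (hyp a c) = c%:C. Proof. exact: pr2_idem. Qed.

Lemma pr1_hnorm Z : pr1 (hnorm Z) = (nrm (pr1 Z))%:C.
Proof. by rewrite pr1_idem nrmE. Qed.

Lemma pr2_hnorm Z : pr2 (hnorm Z) = (nrm (pr2 Z))%:C.
Proof. by rewrite pr2_idem nrmE. Qed.

Lemma pr1M Z Z' : pr1 (Z * Z') = pr1 Z * pr1 Z'. Proof. exact: rmorphM. Qed.

Lemma pr2M Z Z' : pr2 (Z * Z') = pr2 Z * pr2 Z'. Proof. exact: rmorphM. Qed.

Lemma pr1X Z n : pr1 (Z ^+ n) = pr1 Z ^+ n. Proof. exact: rmorphXn. Qed.

Lemma pr2X Z n : pr2 (Z ^+ n) = pr2 Z ^+ n. Proof. exact: rmorphXn. Qed.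

Lemma pr1_hnorm_sqr Z : complex.Re (pr1 (hnorm Z ^+ 2)) = nrm (pr1 Z) ^+ 2.
Proof. by rewrite pr1X pr1_hnorm -rmorphXn. Qed.

Lemma pr2_hnorm_sqr Z : complex.Re (pr2 (hnorm Z ^+ 2)) = nrm (pr2 Z) ^+ 2.
Proof. by rewrite pr2X pr2_hnorm -rmorphXn. Qed.

Lemma idemM (a c a' c' : R[i]) : idem a c * idem a' c' = idem (a * a') (c * c').
Proof. by rewrite [LHS]idemE pr1M pr2M !pr1_idem !pr2_idem. Qed.

Lemma idem11 : idem 1 1 = 1 :> bicomplex R.
Proof. by rewrite [RHS]idemE !rmorph1. Qed.

Lemma hlt_Re (X Y : bicomplex R) : hlt X Y ->
  complex.Re (pr1 X) < complex.Re (pr1 Y) /\ complex.Re (pr2 X) < complex.Re (pr2 Y).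
Proof. by case; rewrite !ltcE => /andP[_ ?] /andP[_ ?]. Qed.

Variables (H1 H2 : hilbert R) (b1 : nat -> H1) (b2 : nat -> H2).
Hypotheses (hb1 : orthonormal_basis b1) (hb2 : orthonormal_basis b2).
Variable V : bicomplex R.
Hypotheses (nu1V : -1 < nu1 V) (nu2V : -1 < nu2 V).

(** Seen as the squared norm of a [fock_vector], which is why a Hilbert space and a basis appear
    among the arguments. *)
Lemma norm_component_ge0 nu (H : hilbert R) (b : nat -> H) z : -1 < nu ->
  orthonormal_basis b -> 0 <= norm_component nu (nrm z ^+ 2).
Proof. by move=> h hb; rewrite -(nrm_fock_vector h hb) sqr_ge0. Qed.

Lemma ketE Z : ket b1 b2 V Z =
  (ket_component (nu1 V) b1 (pr1 Z), ket_component (nu2 V) b2 (pr2 Z)).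
Proof.
rewrite /ket /fock_sum; congr pair => /=; rewrite /ket_component.
  rewrite !pr1_idem pr1_hnorm_sqr sqrtC_real; last exact: norm_component_ge0 hb1.
  rewrite -fmorphV/=; congr (_ *: limn (series _)); apply/funext => n.
  rewrite pr1M pr1X !pr1_idem sqrtC_real; last exact/ltW/rho_component_gt0.
  by rewrite -fmorphV.
rewrite !pr2_idem pr2_hnorm_sqr sqrtC_real; last exact: norm_component_ge0 hb2.
rewrite -fmorphV/=; congr (_ *: limn (series _)); apply/funext => n.
rewrite pr2M pr2X !pr2_idem sqrtC_real; last exact/ltW/rho_component_gt0.
by rewrite -fmorphV.
Qed.

Lemma weightE Z : weight V (hnorm Z) = idem
  (norm_component (nu1 V) (nrm (pr1 Z) ^+ 2) * weight_component (nu1 V) (nrm (pr1 Z)))%:C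
  (norm_component (nu2 V) (nrm (pr2 Z) ^+ 2) * weight_component (nu2 V) (nrm (pr2 Z)))%:C.
Proof.
rewrite /weight /norm_fun /hyp idemM !pr1_hnorm_sqr !pr2_hnorm_sqr pr1_hnorm pr2_hnorm.
by rewrite !rmorphM.
Qed.

End Components.

Lemma resolution_integrand_ket (R : realType) (nu : R) (H : hilbert R) (b : nat -> H)
    (x y : H) (z : R[i]) : -1 < nu -> orthonormal_basis b ->
  ((norm_component nu (nrm z ^+ 2) * weight_component nu (nrm z))%:C *
   (hdot H (ket_component nu b z) x * hdot H y (ket_component nu b z)))%C =
  resolution_integrand nu b x y z.
Proof.
move=> nu1 hb; rewrite /resolution_integrand ket_componentE// -(nrm_fock_vector nu1 hb).
rewrite hdotZl hdotZr.
have n0 : nrm (fock_vector nu b z) != 0.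
  by rewrite gt_eqF// (lt_le_trans _ (nrm_fock_vector_ge1 nu1 hb z)).
set c := (nrm (fock_vector nu b z))^-1.
have -> : ((c%:C)%C)^* = (c%:C)%C by congr (Complex _ _); rewrite oppr0.
have -> : (nrm (fock_vector nu b z) ^+ 2 * weight_component nu (nrm z))%:C%C =
  (c%:C^-1 ^+ 2 * (weight_component nu (nrm z))%:C)%C.
  by rewrite rmorphM rmorphXn/= -fmorphV /c/= invrK.
have c0 : (c%:C)%C != 0 by rewrite fmorph_eq0 invr_eq0.
by field.
Qed.

Theorem mainTheorem11 (R : realType) (H1 H2 : hilbert R)
    (b1 : nat -> H1) (b2 : nat -> H2)
    (hb1 : orthonormal_basis b1) (hb2 : orthonormal_basis b2)
    (V : bicomplex R) (hV : hyperbolic V) (hV1 : hlt (-1) V) :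
  (forall Z : bicomplex R, braket (ket b1 b2 V Z) (ket b1 b2 V Z) = 1) /\
  (forall Z eps : bicomplex R, hlt 0 eps ->
     exists delta : bicomplex R, hlt 0 delta /\
       forall Z' : bicomplex R, hlt (hnorm (Z' - Z)) delta ->
         hlt (bh_norm (ket b1 b2 V Z' - ket b1 b2 V Z)) eps) /\
  (forall Z : bicomplex R, pr1 Z != 0 -> pr2 Z != 0 ->
     hlt 0 (weight V (hnorm Z))) /\
  (forall x y : bhilbert H1 H2,
     has_bc_integral
       (fun Z => weight V (hnorm Z) *
                 (braket x (ket b1 b2 V Z) * braket (ket b1 b2 V Z) y))
       (braket x y)).
Proof.
have p1 : pr1 (-1 : bicomplex R) = -1 by exact: rmorphN1.
have p2 : pr2 (-1 : bicomplex R) = -1 by exact: rmorphN1.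
have [n1 n2] : -1 < nu1 V /\ -1 < nu2 V by have := hlt_Re hV1; rewrite p1 p2.
have p10 : pr1 (0 : bicomplex R) = 0 by exact: rmorph0.
have p20 : pr2 (0 : bicomplex R) = 0 by exact: rmorph0.
have pB1 (X Y : bicomplex R) : pr1 (X - Y) = pr1 X - pr1 Y by exact: raddfB.
have pB2 (X Y : bicomplex R) : pr2 (X - Y) = pr2 X - pr2 Y by exact: raddfB.
have ltc0 (a : R) : 0 < a -> (0 : R[i]) < (a%:C)%C by move=> a0; rewrite ltcR.
have realE (c : R[i]) : 0 < c -> c = ((complex.Re c)%:C)%C.
  by move=> c0; rewrite RRe_real// gtr0_real.
split; [|split; [|split]].
- move=> Z; rewrite /braket !ketE//= !hdot_self.
  by rewrite !nrm_ket_component// expr1n idem11.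
- move=> Z eps []; rewrite p10 p20 => e1 e2.
  have e1' := e1; have e2' := e2; move: e1' e2'.
  rewrite (realE _ e1) (realE _ e2) !ltcR => e1' e2'.
  have [d1 d10 h1] := ket_component_continuous n1 hb1 (pr1 Z) e1'.
  have [d2 d20 h2] := ket_component_continuous n2 hb2 (pr2 Z) e2'.
  (* The idempotent components do not interact, so each modulus of continuity is chosen
     separately. *)
  exists (hyp d1 d2); split.
    by split; rewrite ?pr1_hyp ?pr2_hyp ?p10 ?p20; exact: ltc0.
  move=> Z' []; rewrite pr1_hyp pr2_hyp pr1_hnorm pr2_hnorm !ltcR.
  rewrite pB1 pB2 => /h1 k1 /h2 k2.
  rewrite /bh_norm !ketE//; split; rewrite ?pr1_idem ?pr2_idem /= nrmE.
    by rewrite (realE _ e1) ltcR.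
  by rewrite (realE _ e2) ltcR.
- move=> Z z1 z2; rewrite weightE.
  have pos nu (H : hilbert R) (b : nat -> H) (z : R[i]) : -1 < nu ->
      orthonormal_basis b -> z != 0 ->
      0 < norm_component nu (nrm z ^+ 2) * weight_component nu (nrm z).
    move=> n hb z0; rewrite mulr_gt0//.
      rewrite -(nrm_fock_vector n hb) exprn_gt0//.
      exact: lt_le_trans (nrm_fock_vector_ge1 n hb z).
    rewrite weight_component_gt0// lt_neqAle nrm_ge0 andbT eq_sym.
    by apply: contra z0 => /eqP/nrm_eq0 ->.
  split; rewrite ?pr1_idem ?pr2_idem ?p10 ?p20; apply: ltc0.
    exact: pos hb1 z1.
  exact: pos hb2 z2.
- move=> x y.
  have [i1 e1] := resolution_of_unity n1 hb1 x.1 y.1.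
  have [i2 e2] := resolution_of_unity n2 hb2 x.2 y.2.
  exists (resolution_integrand (nu1 V) b1 x.1 y.1), (resolution_integrand (nu2 V) b2 x.2 y.2).
  split=> //; last by rewrite e1 e2.
  move=> Z; rewrite weightE /braket ketE//= !idemM.
  by rewrite !resolution_integrand_ket.
Qed.
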